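(* Let $(X_n,\Delta_n)_{n\ge0}$ and $(Y_n,\Lambda_n)_{n\ge 0}$ be two models of approximately linear recursions, with coefficients $(a_{n,i})_{1\le i\le k}$ and $(b_{n,j})_{1\le j\le \ell}$ respectively ($k,\ell\ge2$), such that the random variables from the two models are independent of each other for all $n\ge 0$, and let $Z_n=X_n+Y_n$. Assume the following for the model $(X_n,\Delta_n)$. (X1) For each $i=1,\dots,k$, $a_{n,i}\to a_i\in\mathbb{R}$ as $n\to\infty$, and at least two of the $a_i$ are nonzero; put $\lambda_a^2=\sum_{i=1}^k a_i^2$ ($\lambda_a>0$). There are $0<\delta_{X,2}<\delta_{\Delta,2}<1$ and positive constants $C_{X,2},C_{\Delta,2}$ such that for all $n\ge0$, $\mathrm{Var}(X_n)\ge C_{X,2}^2\lambda_a^{2n}(1-\delta_{X,2})^{2n}$ and $\mathrm{Var}(\Delta_n)\le C_{\Delta,2}^2\lambda_a^{2n}(1-\delta_{\Delta,2})^{2n}$. (X2) There are $\delta_{X,4}\ge0$ and $\delta_{\Delta,4}\ge0$ such that $$\frac{(1-\delta_{\Delta,2})(1+\delta_{X,4})^3}{(1-\delta_{X,2})^4}<1,\qquad \left(\frac{1-\delta_{\Delta,4}}{1-\delta_{X,2}}\right)^2<1,$$ and positive constants $C_{X,4},C_{\Delta,4}$ such that for all $n\ge0$, $E(X_n-EX_n)^4\le C_{X,4}^4\lambda_a^{4n}(1+\delta_{X,4})^{4n}$ and $E(\Delta_n-E\Delta_n)^4\le C_{\Delta,4}^4\lambda_a^{4n}(1-\delta_{\Delta,4})^{4n}$.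 Assume likewise for the model $(Y_n,\Lambda_n)$: (Y1) For each $j=1,\dots,\ell$, $b_{n,j}\to b_j\in\mathbb{R}$ as $n\to\infty$, and at least two of the $b_j$ are nonzero; put $\lambda_b^2=\sum_{j=1}^\ell b_j^2$ ($\lambda_b>0$). There are $0<\delta_{Y,2}<\delta_{\Lambda,2}<1$ and positive constants $C_{Y,2},C_{\Lambda,2}$ such that for all $n\ge0$, $\mathrm{Var}(Y_n)\ge C_{Y,2}^2\lambda_b^{2n}(1-\delta_{Y,2})^{2n}$ and $\mathrm{Var}(\Lambda_n)\le C_{\Lambda,2}^2\lambda_b^{2n}(1-\delta_{\Lambda,2})^{2n}$. (Y2) There are $\delta_{Y,4}\ge0$ and $\delta_{\Lambda,4}\ge0$ such that $$\frac{(1-\delta_{\Lambda,2})(1+\delta_{Y,4})^3}{(1-\delta_{Y,2})^4}<1,\qquad \left(\frac{1-\delta_{\Lambda,4}}{1-\delta_{Y,2}}\right)^2<1,$$ and positive constants $C_{Y,4},C_{\Lambda,4}$ such that for all $n\ge0$, $E(Y_n-EY_n)^4\le C_{Y,4}^4\lambda_b^{4n}(1+\delta_{Y,4})^{4n}$ and $E(\Lambda_n-E\Lambda_n)^4\le C_{\Lambda,4}^4\lambda_b^{4n}(1-\delta_{\Lambda,4})^{4n}$. Suppose moreover that $$\frac{(1-\delta_{\Lambda,2})(1+\delta_{X,4})^3}{(1-\delta_{Y,2})(1-\delta_{X,2})^3}<1\quad\text{and}\quad \frac{(1-\delta_{\Delta,2})(1+\delta_{Y,4})^3}{(1-\delta_{X,2})(1-\delta_{Y,2})^3}<1,$$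 and that for all $n\ge 0$ $$|\mathrm{Var}(X_n)-\mathrm{Var}(Y_n)|\le\frac{\mathrm{Var}(\Delta_n)+\mathrm{Var}(\Lambda_n)}{\max\{\lambda_{a,n}^2,\lambda_{b,n}^2\}}.$$ Then there exist constants $C>0$ and $\gamma\in(0,1)$ such that for all $n\ge0$ $$\|\mathcal{L}(\widetilde Z_n)-\mathcal{L}(Z)\|_1\le C\gamma^n,$$ where $Z$ is a standard normal random variable.
   Context: Models: $X_0$ is a non-constant random variable with finite variance, $k\ge2$ is an integer, $a_{n,1},\dots,a_{n,k}$ are real numbers, and for all $n\ge0$, $X_{n+1}=\sum_{i=1}^k a_{n,i}X_{n,i}+\Delta_n$, where $X_{n,1},\dots,X_{n,k}$ are independent copies of $X_n$ and $\Delta_n$ is a random variable (the perturbation), which may depend on the $X_{n,i}$. Similarly $Y_0$ is a non-degenerate random variable, $\ell\ge2$ is an integer, $b_{n,1},\dots,b_{n,\ell}$ are real numbers, and for all $n\ge0$, $Y_{n+1}=\sum_{j=1}^\ell b_{n,j}Y_{n,j}+\Lambda_n$, where $Y_{n,1},\dots,Y_{n,\ell}$ are independent copies of $Y_n$ and $\Lambda_n$ is a random variable (the perturbation), which may depend on the $Y_{n,j}$. Notation: $\lambda_{a,n}^2=\sum_{i=1}^k a_{n,i}^2$, $\lambda_{b,n}^2=\sum_{j=1}^\ell b_{n,j}^2$, $\sigma_n^2=\mathrm{Var}(Z_n)=\mathrm{Var}(X_n)+\mathrm{Var}(Y_n)$ with $\sigma_n>0$, and $\widetilde Z_n=(Z_n-EZ_n)/\sigma_n$.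 $\mathcal{L}(W)$ denotes the law (cumulative distribution function) of a random variable $W$, and for distribution functions $F,G$, $\|F-G\|_1=\int_{-\infty}^\infty|F(t)-G(t)|\,dt$ (the $L^1$ or Wasserstein distance). *)

(* Defs.v *)
From HB Require Import structures.
From mathcomp Require Import all_boot all_order all_algebra.
From mathcomp Require Import all_classical all_reals all_analysis.
From mathcomp Require Import measurable_realfun.

Set Implicit Arguments.
Unset Strict Implicit.
Unset Printing Implicit Defensive.

Import Order.TTheory GRing.Theory Num.Theory.
Import numFieldNormedType.Exports.

Local Open Scope classical_set_scope.
Local Open Scope ring_scope.

Section probability_notions.
Context {d : measure_display} {T : measurableType d} {R : realType}.
Variable P : probability T R.

(* Taking [A i = setT] gives the product rule for every subfamily. *)
Definition mutually_independent (I : finType) (U : I -> {RV P >-> R}) : Prop :=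
  forall A : I -> set R, (forall i, measurable (A i)) ->
    P (\bigcap_i (U i @^-1` A i)) = (\prod_(i in I) P (U i @^-1` A i))%E.

Definition sigma_generated (I : Type) (U : I -> {RV P >-> R}) : set (set T) :=
  <<s \bigcup_i preimage_set_system setT (U i) measurable >>.

Definition independent_families (I J : Type)
    (U : I -> {RV P >-> R}) (V : J -> {RV P >-> R}) : Prop :=
  forall A B, sigma_generated U A -> sigma_generated V B ->
    P (A `&` B) = (P A * P B)%E.

Definition as_constant (W : {RV P >-> R}) : Prop :=
  exists c : R, {ae P, forall w, W w = c}.

(* [fine] is harmless: a finite fourth moment about any real point puts W in L^4. *)
Definition central_moment4 (W : T -> R) : \bar R :=
  ('E_P[(fun w => (W w - fine 'E_P[W]) ^+ 4)%R])%E.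

Definition standardize (W : T -> R) (w : T) : R :=
  (W w - fine 'E_P[W]) / Num.sqrt (fine 'V_P[W]).

End probability_notions.

Section standardize_measurable.
Context {d : measure_display} {T : measurableType d} {R : realType}.
Variables (P : probability T R) (W : {mfun T >-> R}).

Let standardize_measurable : measurable_fun setT (standardize P W).
Proof.
apply: measurable_funM; last exact: measurable_cst.
by apply: measurable_funB; last exact: measurable_cst.
Qed.

HB.instance Definition _ :=
  isMeasurableFun.Build _ _ _ _ (standardize P W) standardize_measurable.

End standardize_measurable.

Definition same_law {d d' : measure_display} {T : measurableType d}
    {T' : measurableType d'} {R : realType} {P : probability T R}
    {P' : probability T' R} (U : {RV P >-> R}) (V : {RV P' >-> R}) : Prop :=
  forall A : set R, measurable A -> distribution P U A = distribution P' V A.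

Definition is_standard_normal {d : measure_display} {T : measurableType d}
    {R : realType} {P : probability T R} (W : {RV P >-> R}) : Prop :=
  forall A : set R, measurable A -> distribution P W A = normal_prob 0 1 A.

Definition L1_dist {R : realType} (F G : R -> \bar R) : \bar R :=
  (\int[lebesgue_measure]_t `|F t - G t|)%E.

Definition lambda {R : realType} (k : nat) (v : 'I_k -> R) : R :=
  Num.sqrt (\sum_(i < k) v i ^+ 2).

Section recursion.
Context {d : measure_display} {T : measurableType d} {R : realType}.
Variable P : probability T R.

(* [copies n i] is the variable X_{n,i}; [pert n] is the perturbation, on which
   no independence is imposed. *)
Record approx_linear_recursion (k : nat) (a : nat -> 'I_k -> R)
    (X : nat -> {RV P >-> R}) (copies : nat -> 'I_k -> {RV P >-> R})
    (pert : nat -> {RV P >-> R}) : Prop := {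
  alr_arity : (2 <= k)%N ;
  alr_finite_variance : (X 0%N : T -> R) \in Lfun P 2%:E ;
  alr_nonconstant : ~ as_constant (X 0%N) ;
  alr_copies_law : forall n i, same_law (copies n i) (X n) ;
  alr_copies_indep : forall n, mutually_independent (copies n) ;
  alr_step : forall n, {ae P, forall w,
    X n.+1 w = \sum_(i < k) a n i * copies n i w + pert n w}
}.

(* All variables attached to stage n; used to state independence of two models. *)
Definition stage (k : nat) (X : nat -> {RV P >-> R})
    (copies : nat -> 'I_k -> {RV P >-> R}) (pert : nat -> {RV P >-> R})
    (n : nat) (i : option (option 'I_k)) : {RV P >-> R} :=
  match i with
  | None => X n
  | Some None => pert n
  | Some (Some j) => copies n j
  end.

Record variance_condition (k : nat) (a : nat -> 'I_k -> R) (alim : 'I_k -> R)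
    (X pert : nat -> {RV P >-> R}) (dX2 dD2 CX2 CD2 : R) : Prop := {
  vc_cvg : forall i, a n i @[n --> \oo] --> alim i ;
  vc_two_nonzero : exists i j, [/\ i != j, alim i != 0 & alim j != 0] ;
  vc_delta : 0 < dX2 < dD2 /\ dD2 < 1 ;
  vc_const : 0 < CX2 /\ 0 < CD2 ;
  vc_lower : forall n, ((CX2 ^+ 2 * lambda alim ^+ (2 * n)
      * (1 - dX2) ^+ (2 * n))%:E <= 'V_P[X n])%E ;
  vc_upper : forall n, ('V_P[pert n] <= (CD2 ^+ 2 * lambda alim ^+ (2 * n)
      * (1 - dD2) ^+ (2 * n))%:E)%E
}.

Record fourth_moment_condition (k : nat) (alim : 'I_k -> R)
    (X pert : nat -> {RV P >-> R}) (dX2 dD2 dX4 dD4 CX4 CD4 : R) : Prop := {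
  fc_delta : 0 <= dX4 /\ 0 <= dD4 ;
  fc_ratio1 : (1 - dD2) * (1 + dX4) ^+ 3 / (1 - dX2) ^+ 4 < 1 ;
  fc_ratio2 : ((1 - dD4) / (1 - dX2)) ^+ 2 < 1 ;
  fc_const : 0 < CX4 /\ 0 < CD4 ;
  fc_main : forall n, (central_moment4 P (X n) <=
    (CX4 ^+ 4 * lambda alim ^+ (4 * n) * (1 + dX4) ^+ (4 * n))%:E)%E ;
  fc_pert : forall n, (central_moment4 P (pert n) <=
    (CD4 ^+ 4 * lambda alim ^+ (4 * n) * (1 - dD4) ^+ (4 * n))%:E)%E
}.

End recursion.

(* Main.v *)
Require Import Defs.
From HB Require Import structures.
From mathcomp Require Import all_boot all_order all_algebra.
From mathcomp Require Import all_classical all_reals all_analysis.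
From mathcomp Require Import measurable_realfun ring lra.

Import Order.TTheory GRing.Theory Num.Theory.
Import numFieldNormedType.Exports.

Local Open Scope classical_set_scope.
Local Open Scope ring_scope.

(** Each of the two normalized sequences converges to the normal law by itself,
    at a geometric rate, when closeness is measured on characteristic functions;
    since [X n] and [Y n] are independent, the normalized sum is
    [a * X~ + b * Y~] with [a ^+ 2 + b ^+ 2 = 1] and inherits the rate.

    For a centred variable [W] of variance 1, [gauss_close P W delta] bounds the
    distance at [t] between the characteristic functions of [W] and of N(0,1) by
    [delta * |t| ^+ 3].  In one step of the recursion the normalized [X n.+1] is a
    small L2-perturbation of [U = \sum_i c_i V_i], where the [V_i] are independent
    copies of the normalized [X n] and [c_i = a_(n,i) / lambda_n], so that the
    [c_i ^+ 2] sum to 1.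
    - The normal law is reproduced by such combinations, so exchanging the [V_i]
      for normal variables one at a time shows that [U] is close to normal with
      constant [delta * \sum_i |c_i| ^+ 3] ([gauss_close_lincomb]).  Two of the
      limits of the coefficients are nonzero, hence this factor is eventually
      below some [kappa < 1] ([sum_cube_weights_lt1]).
    - [X~] and [U] have the same mean and variance, so the Taylor terms of order
      at most two cancel in the difference of their characteristic functions, and
      what is left is at most [|t| ^+ 3] times the expectation of
      [|X~ - U| * (X~ ^+ 2 + U ^+ 2)] ([gauss_close_perturb]).  The variance
      hypotheses give [E (X~ - U) ^+ 2 = O(rho ^+ (2 * n))] with
      [rho = (1 - dD2) / (1 - dX2)], the fourth moment hypothesis gives
      [E X~ ^+ 4 = O(r ^+ (4 * n))] with [r = (1 + dX4) / (1 - dX2) >= 1], and the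
      ratio hypothesis is [rho * r ^+ 3 < 1], which implies [rho * r ^+ 2 < 1].
    The constants therefore satisfy
    [delta_(n+1) <= kappa * delta_n + B * (rho * r ^+ 2) ^+ n] and decay
    geometrically ([geometric_recursion], [recursion_gauss_close]).

    It remains to pass from characteristic functions to the L1 distance of the
    distribution functions.  The normal density is its own Fourier transform
    ([integral_cos_phi]), so the density of the law of [W] convolved with N(0,e^2) is
    an integral of the characteristic function of [W] against a Gaussian weight, and
    closeness of characteristic functions makes the smoothed densities uniformly
    close ([gauss_average_close]).  Integrating over an interval and bounding the
    effect of the smoothing by a normal tail compares the distribution functions
    on a bounded interval ([cdf_le_smoothing]); outside of it both tails are
    [O(1 / x ^+ 2)] by the Chebyshev inequality.  If [delta = A * u ^+ 15], then
    the smoothing scale [u ^+ 3], the shift [2 * u ^+ 2] and the cut-off [1 / u] make every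
    contribution [O(u)] ([L1_dist_cdf_le]), and a geometric [u] suffices. *)

(** * Independence *)

Section independence.
Context {d : measure_display} {T : measurableType d} {R : realType}.
Variable P : probability T R.

Definition indep_pair (U V : T -> R) : Prop :=
  forall A B : set R, measurable A -> measurable B ->
    P (U @^-1` A `&` V @^-1` B) = (P (U @^-1` A) * P (V @^-1` B))%E.

Lemma indep_pair_comp (U V : T -> R) (f g : R -> R) :
  measurable_fun setT f -> measurable_fun setT g ->
  indep_pair U V -> indep_pair (f \o U) (g \o V).
Proof.
move=> mf mg UV A B mA mB; apply: (UV (f @^-1` A) (g @^-1` B)).
  by rewrite -[X in measurable X]setTI; exact: mf.
by rewrite -[X in measurable X]setTI; exact: mg.
Qed.

(** The joint law of an independent pair is the product of the two laws, so [V]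
    may be replaced by an independent copy.  Writing the copy as a second
    integral over the same space avoids introducing the laws. *)
Lemma integral_indep_pair (U V : {mfun T >-> R}) (F : R -> R -> R) :
  indep_pair U V ->
  measurable_fun setT (fun z : R * R => F z.1 z.2) ->
  P.-integrable setT (EFin \o (fun w => F (U w) (V w))) ->
  (forall u, P.-integrable setT (EFin \o (fun w => F u (V w)))) ->
  (\int[P]_w F (U w) (V w) = \int[P]_w \int[P]_w' F (U w) (V w'))%R.
Proof.
move=> UV mF iF iFV.
pose UVp : T -> R * R := fun w => (U w, V w).
have mUV : measurable_fun setT UVp by exact: measurable_fun_pair.
pose G : R * R -> \bar R := EFin \o (fun z => F z.1 z.2).
have mG : measurable_fun setT G by exact/measurable_EFinP.
pose muU := distribution P U; pose muV := distribution P V.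
pose UVm : {mfun T >-> (R * R)%type} :=
  HB.pack UVp (isMeasurableFun.Build _ _ _ _ UVp mUV).
pose muUV := distribution P UVm.
have E X : measurable X -> (muU \x muV)%E X = muUV X.
  apply: product_measure_unique => A B mA mB.
  exact: UV.
have iG : muUV.-integrable setT G by apply: integrable_pushforward.
have iG' : (muU \x muV)%E.-integrable setT G.
  move/integrableP: iG => [_ iG]; apply/integrableP; split => //.
  rewrite (eq_measure_integral muUV)// => A mA _; exact: E.
have -> : (\int[P]_w F (U w) (V w))%R = fine (\int[muUV]_z G z)%E.
  by rewrite integral_distribution.
have -> : (\int[muUV]_z G z)%E = (\int[(muU \x muV)%E]_z G z)%E.
  by apply/esym/eq_measure_integral => A mA _; exact: E.
rewrite -integral12_prod_meas1//.
have iGF := integrable_fubini_F iG'.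
have GFE u : fubini_F muV G u = (\int[P]_w' F u (V w'))%:E.
  have mGu : measurable_fun setT (fun v => G (u, v)).
    by apply: (measurableT_comp mG); exact: measurable_fun_pair.
  rewrite /fubini_F (integral_distribution (f := fun v => G (u, v)))//; last exact: iFV.
  by rewrite fineK//; apply: integrable_fin_num => //; exact: iFV.
rewrite integral_distribution; [|exact: measurable_int iGF|].
  by rewrite /Rintegral; congr fine; apply: eq_integral => w _ /=; rewrite GFE.
apply/integrableP; split; first exact: measurableT_comp (measurable_int _ iGF) _.
rewrite -(ge0_integral_distribution U (f := fun u => `|fubini_F muV G u|%E))//.
  by move/integrableP: iGF => [].
by apply: measurableT_comp => //; exact: measurable_int iGF.
Qed.
End independence.

Section partial_sums.
Context {d : measure_display} {T : measurableType d} {R : realType}.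
Variable P : probability T R.
Variables (I : finType) (U : I -> {mfun T >-> R}).

(** The sets [\bigcap_j (U j @^-1` C j)] in which [C i] is the whole line form a
    pi-system independent of [U i]; two finite measures that agree on a
    pi-system agree on the sigma-algebra it generates, and the partial sum is
    measurable for the latter. *)
Lemma indep_pair_sum (c : I -> R) (s : seq I) (i : I) :
  mutually_independent (P := P) U -> i \notin s ->
  indep_pair P (fun w => \sum_(j <- s) c j * U j w) (U i).
Proof.
move=> indU isn A B mA mB.
pose G : set (set T) := [set E | exists2 C : I -> set R,
  (forall j, measurable (C j)) & C i = setT /\ E = \bigcap_j (U j @^-1` C j)].
have GT : G setT.
  exists (fun=> setT) => //; split => //; apply/seteqP; split => // w _ j _ //.
have mpre j C : measurable C -> measurable (U j @^-1` C).
  by move=> mC; rewrite -[X in measurable X]setTI; exact: (measurable_funP (U j)) => //.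
have Gm : G `<=` measurable.
  move=> E [C mC [_ ->]]; 
  apply: fin_bigcap_measurable; first exact: (@finite_finset I).
  by move=> j _; exact: mpre.
have GI : setI_closed G.
  move=> E F [C mC [Ci ->]] [D mD [Di ->]].
  exists (fun j => C j `&` D j); first by move=> j; exact: measurableI.
  split; first by rewrite Ci Di setIT.
  by rewrite bigcapI.
have mVB := mpre i B mB.
(* [m1 E] is P(E and U i in B), [m2 E] is P(E) P(U i in B). *)
pose m1 := mrestr P mVB.
have PB0 : 0 <= fine (P (U i @^-1` B)) by exact: fine_ge0.
pose m2 := mscale (NngNum PB0) P.
have m12 E : G E -> m1 E = m2 E.
  move=> [C mC [Ci ->]].
  rewrite /m1 /m2 /mrestr /mscale /=.
  rewrite fineK ?fin_num_measure//.
  have -> : \bigcap_j (U j @^-1` C j) `&` U i @^-1` B =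
    \bigcap_j (U j @^-1` (if j == i then B else C j)).
    apply/seteqP; split => w /=.
      by move=> [h1 h2] j _; case: eqP => [->|_] //; exact: h1.
    move=> h; split; last by have := h i Logic.I; rewrite /= eqxx.
    move=> j _; have := h j Logic.I; rewrite /=; case: eqP => // -> _.
    by rewrite Ci.
  rewrite !indU//; last by move=> j; case: ifP.
  rewrite (bigD1 i)//= eqxx [in RHS](bigD1 i)//= Ci preimage_setT.
  rewrite [P setT]probability_setT mul1e; congr (_ * _)%E.
  by apply: eq_bigr => j /negbTE ->.
have sG E : <<s G >> E -> m1 E = m2 E.
  apply: (g_sigma_algebra_measure_unique G Gm (fun=> setT)) => //.
    by rewrite bigcup_const.
  move=> _; change (P (setT `&` U i @^-1` B) < +oo)%E; rewrite setTI.
  by apply: (le_lt_trans (probability_le1 P mVB)); rewrite ltry.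
have mU j : j != i -> measurable_fun setT (U j : g_sigma_algebraType G -> R).
  move=> ji _ C mC; rewrite setTI; apply: sub_sigma_algebra.
  exists (fun l => if l == j then C else setT); first by move=> l; case: ifP.
  rewrite eq_sym (negbTE ji); split=> //; apply/seteqP; split => w /=.
    by move=> h l _; case: eqP => // ->.
  by move=> /(_ j Logic.I); rewrite /= eqxx.
have mS : measurable_fun setT
    ((fun w => \sum_(j <- s) c j * U j w) : g_sigma_algebraType G -> R).
  elim: s isn => [_|j s IH].
    by under eq_fun do rewrite big_nil; exact: measurable_cst.
  rewrite inE negb_or => /andP[ij /IH ms].
  under eq_fun do rewrite big_cons.
  apply: measurable_funD => //; apply: measurable_funM => //.
  by apply: mU; rewrite eq_sym.
have := mS measurableT A mA; rewrite setTI => /sG.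
rewrite /m1 /m2 /mrestr /mscale /= => ->.
by rewrite fineK ?fin_num_measure// muleC.
Qed.
End partial_sums.

(** * Characteristic functions in real form *)
Lemma measurable_cos_affine {d : measure_display} {T : measurableType d}
    {R : realType} (W : T -> R) (t s : R) : measurable_fun setT W ->
  measurable_fun setT (fun w => cos (t * W w + s)).
Proof.
move=> mW; apply: measurableT_comp; first by apply: continuous_measurable_fun; exact: continuous_cos.
by apply: measurable_funD => //; exact: measurable_funM.
Qed.


Section integrability.
Context {d : measure_display} {T : measurableType d} {R : realType}.
Variable mu : {measure set T -> \bar R}.

Lemma integrable_dominated (f g : T -> R) : measurable_fun setT f ->
  (forall w, `|f w| <= g w) -> mu.-integrable setT (EFin \o g) ->
  mu.-integrable setT (EFin \o f).
Proof.
move=> mf fg ig; apply: le_integrable ig => //; first exact/measurable_EFinP.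
by move=> w _ /=; rewrite lee_fin (le_trans (fg w))// ler_norm.
Qed.

Lemma integrable_add (f g : T -> R) :
  mu.-integrable setT (EFin \o f) -> mu.-integrable setT (EFin \o g) ->
  mu.-integrable setT (EFin \o (fun w => f w + g w)).
Proof. by move=> fi gi; have := integrableD measurableT fi gi. Qed.

Lemma integrable_sub (f g : T -> R) :
  mu.-integrable setT (EFin \o f) -> mu.-integrable setT (EFin \o g) ->
  mu.-integrable setT (EFin \o (fun w => f w - g w)).
Proof. by move=> fi gi; have := integrableB measurableT fi gi. Qed.

Lemma integrable_scale (c : R) (f : T -> R) :
  mu.-integrable setT (EFin \o f) -> mu.-integrable setT (EFin \o (fun w => c * f w)).
Proof. by move=> fi; have := integrableZl measurableT c fi. Qed.

End integrability.

Section trigonometric_transform.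
Context {d : measure_display} {T : measurableType d} {R : realType}.
Variable P : probability T R.

Lemma integrable_cst (c : R) : P.-integrable setT (EFin \o (fun _ : T => c)).
Proof. exact: finite_measure_integrable_cst. Qed.

Lemma integrable_bounded (M : R) (f : T -> R) : measurable_fun setT f ->
  (forall w, `|f w| <= M) -> P.-integrable setT (EFin \o f).
Proof. by move=> mf fM; apply: (integrable_dominated P _ (fun=> M)) => //; exact: integrable_cst. Qed.

Lemma Rintegral_cst_prob (c : R) : \int[P]_w c = c.
Proof.
rewrite (Rintegral_cst P measurableT c) -[RHS]mulr1; congr (_ * _).
exact: (congr1 fine (probability_setT P)).
Qed.

Lemma Rintegral_dist_le (f g : T -> R) (M : R) :
  P.-integrable setT (EFin \o f) -> P.-integrable setT (EFin \o g) ->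
  (forall w, `|f w - g w| <= M) -> `| \int[P]_w f w - \int[P]_w g w | <= M.
Proof.
move=> fi gi fgM; rewrite -RintegralB//.
have ifg : P.-integrable setT (EFin \o (fun w => f w - g w)) by exact: integrable_sub.
apply: (le_trans (le_normr_Rintegral _ _)) => //.
rewrite -[leRHS](Rintegral_cst_prob M); apply: le_Rintegral => //.
- exact: integrable_norm.
- exact: integrable_cst.
Qed.

Lemma integrable_cos_affine (W : T -> R) (t s : R) : measurable_fun setT W ->
  P.-integrable setT (EFin \o (fun w => cos (t * W w + s))).
Proof.
move=> mW; apply: (integrable_bounded 1); first exact: measurable_cos_affine.
by move=> w; rewrite ler_norml cos_geN1 cos_le1.
Qed.

(** The phase [s] replaces complex numbers: the supremum over [s] of the left-hand
    side is the modulus of the difference of the characteristic functions at [t],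
    because [cos] of a phase is the real part of a unit complex number. *)
Definition gauss_close (W : T -> R) (delta : R) : Prop := forall t s : R,
  `| \int[P]_w cos (t * W w + s) - expR (- (t ^+ 2 / 2)) * cos s |
    <= delta * `|t| ^+ 3.

Lemma gauss_close_le (W : T -> R) (x y : R) :
  x <= y -> gauss_close W x -> gauss_close W y.
Proof.
move=> xy Wx t s; apply: (le_trans (Wx t s)).
by rewrite ler_wpM2r// exprn_ge0.
Qed.

(** As a function of the phase the integral is a combination of [cos] and [sin];
    in particular it is measurable in the phase. *)
Lemma Rintegral_cos_phase (W : T -> R) (t s : R) : measurable_fun setT W ->
  \int[P]_w cos (t * W w + s) =
  (\int[P]_w cos (t * W w + 0)) * cos s + (\int[P]_w cos (t * W w + pi / 2)) * sin s.
Proof.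
move=> mW.
rewrite -!RintegralZr//; [|exact: integrable_cos_affine..].
rewrite -RintegralD//.
- apply: eq_Rintegral => w _; rewrite addr0 cosD [in RHS]cosD cos_pihalf sin_pihalf; ring.
- under [X in _.-integrable _ X]eq_fun do rewrite /= mulrC.
  exact: integrable_scale (integrable_cos_affine _ _ _ mW).
- under [X in _.-integrable _ X]eq_fun do rewrite /= mulrC.
  exact: integrable_scale (integrable_cos_affine _ _ _ mW).
Qed.

(** One step of the exchange argument: conditionally on [S], the summand [c * V]
    sees the phase [t * S + s], and [gauss_close] is uniform in the phase. *)
Lemma gauss_close_swap (S V : {mfun T >-> R}) (c delta t s : R) :
  indep_pair P S V -> gauss_close V delta ->
  `| \int[P]_w cos (t * (S w + c * V w) + s)
     - expR (- ((c * t) ^+ 2 / 2)) * \int[P]_w cos (t * S w + s) |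
    <= delta * `|c * t| ^+ 3.
Proof.
move=> SV Vd.
rewrite (integral_indep_pair P S V (fun x y => cos (t * (x + c * y) + s)))//; first last.
- move=> u; apply: (integrable_bounded 1) => [|w]; last by rewrite ler_norml cos_geN1 cos_le1.
  apply: measurable_cos_affine; apply: measurable_funD => //; exact: measurable_funM.
- apply: (integrable_bounded 1) => [|w]; last by rewrite ler_norml cos_geN1 cos_le1.
  apply: measurable_cos_affine; apply: measurable_funD => //; exact: measurable_funM.
- apply: measurable_cos_affine; apply: measurable_funD => //; exact: measurable_funM.
have E w : \int[P]_w' cos (t * (S w + c * V w') + s) =
           \int[P]_w' cos ((c * t) * V w' + (t * S w + s)).
  by apply: eq_Rintegral => w' _; congr cos; ring.
rewrite -RintegralZl//; last exact: integrable_cos_affine.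
apply: Rintegral_dist_le.
- have -> : (fun w => \int[P]_w' cos (t * (S w + c * V w') + s)) = (fun w =>
     (\int[P]_w' cos ((c * t) * V w' + 0)) * cos (t * S w + s) +
     (\int[P]_w' cos ((c * t) * V w' + pi / 2)) * cos (t * S w + (s - pi / 2))).
    apply/funext => w; rewrite E Rintegral_cos_phase//; congr (_ + _ * _).
    by rewrite addrA cosB cos_pihalf sin_pihalf mulr0 add0r mulr1.
  apply: integrable_add.
    exact: integrable_scale (integrable_cos_affine _ _ _ _).
  exact: integrable_scale (integrable_cos_affine _ _ _ _).
- exact: integrable_scale (integrable_cos_affine _ _ _ _).
- by move=> w; rewrite E; exact: Vd.
Qed.
End trigonometric_transform.

Section sums.
Context {d : measure_display} {T : measurableType d} {R : realType}.
Variable P : probability T R.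

Definition mfun_of (f : T -> R) (mf : measurable_fun setT f) : {mfun T >-> R} :=
  HB.pack f (isMeasurableFun.Build _ _ _ _ f mf).

Lemma measurable_lincomb (I : Type) (U : I -> {mfun T >-> R}) (c : I -> R) (r : seq I) :
  measurable_fun setT (fun w => \sum_(i <- r) c i * U i w).
Proof.
elim: r => [|i r IH]; first by under eq_fun do rewrite big_nil; exact: measurable_cst.
under eq_fun do rewrite big_cons.
by apply: measurable_funD => //; exact: measurable_funM.
Qed.

(** Exchanging one summand multiplies the remaining integral by a factor at most 1,
    so the errors of the successive exchanges add up. *)
Lemma integral_cos_lincomb (I : finType) (U : I -> {mfun T >-> R}) (c : I -> R)
    (delta : R) (r : seq I) (t s : R) :
  mutually_independent (P := P) U -> (forall i, gauss_close P (U i) delta) ->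
  uniq r ->
  `| \int[P]_w cos (t * (\sum_(i <- r) c i * U i w) + s)
     - expR (- (t ^+ 2 / 2 * \sum_(i <- r) c i ^+ 2)) * cos s |
    <= delta * (\sum_(i <- r) `|c i| ^+ 3) * `|t| ^+ 3.
Proof.
move=> indU Ud; elim: r => [_|i r IH /= /andP[ir ur]].
  under eq_Rintegral do rewrite big_nil mulr0 add0r.
  by rewrite Rintegral_cst_prob !big_nil !mulr0 oppr0 expR0 mul1r subrr normr0 mul0r.
have ind : indep_pair P (mfun_of _ (measurable_lincomb I U c r)) (U i).
  exact: indep_pair_sum.
have := gauss_close_swap P _ _ (c i) delta t s ind (Ud i).
set J1 := \int[P]_w _; set J2 := \int[P]_w _ => H1.
have -> : \int[P]_w cos (t * (\sum_(j <- i :: r) c j * U j w) + s) = J1.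
  by apply: eq_Rintegral => w _; rewrite big_cons addrC [in RHS]addrC [_ + c i * _]addrC.
have H2 := IH ur; rewrite -/J2 in H2.
rewrite !big_cons [X in expR (- X)](_ : _ =
   (c i * t) ^+ 2 / 2 + t ^+ 2 / 2 * (\sum_(j <- r) c j ^+ 2)); last by ring.
rewrite opprD expRD -mulrA.
set e1 := expR (- ((c i * t) ^+ 2 / 2)) in H1 *.
set e2 := expR (- (_ * \sum_(j <- r) _)) in H2 *.
have e1_le1 : e1 <= 1.
  by rewrite -expR0 ler_expR oppr_le0 mulr_ge0 ?sqr_ge0 ?invr_ge0.
have e1_ge0 : 0 <= e1 by exact: expR_ge0.
rewrite (_ : J1 - _ = (J1 - e1 * J2) + e1 * (J2 - e2 * cos s)); last by ring.
apply: (le_trans (ler_normD _ _)).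
rewrite [leRHS](mulrAC _ (_ + _)) (mulrDr _ _ (\sum_(j <- r) _)) -!(mulrAC _ _ (`|t| ^+ 3)).
apply: lerD.
  by rewrite normrM exprMn mulrA in H1.
rewrite normrM (ger0_norm e1_ge0).
by apply: le_trans H2; exact: ler_piMl.
Qed.

Lemma gauss_close_lincomb (I : finType) (U : I -> {mfun T >-> R}) (c : I -> R)
    (delta : R) :
  mutually_independent (P := P) U -> (forall i, gauss_close P (U i) delta) ->
  \sum_i c i ^+ 2 = 1 ->
  gauss_close P (fun w => \sum_i c i * U i w) (delta * \sum_i `|c i| ^+ 3).
Proof.
move=> indU Ud c1 t s.
have := integral_cos_lincomb I U c delta (index_enum I) t s indU Ud (index_enum_uniq I).
by rewrite c1 mulr1.
Qed.

Lemma gauss_close_pair (U V : {mfun T >-> R}) (a b dU dV : R) :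
  indep_pair P U V -> gauss_close P U dU -> gauss_close P V dV ->
  a ^+ 2 + b ^+ 2 = 1 ->
  gauss_close P (fun w => a * U w + b * V w) (dU * `|a| ^+ 3 + dV * `|b| ^+ 3).
Proof.
move=> UV Ud Vd ab t s.
have maU : measurable_fun setT (fun w => a * U w) by exact: measurable_funM.
have ind : indep_pair P (mfun_of _ maU) V.
  apply: (indep_pair_comp P U V (fun x => a * x) idfun) => //.
    exact: measurable_funM.
  exact: measurable_id.
have := gauss_close_swap P _ _ b dV t s ind Vd.
set J1 := \int[P]_w _; set J2 := \int[P]_w _ => H1.
have := Ud (a * t) s.
have -> : \int[P]_w cos (a * t * U w + s) = J2.
  by apply: eq_Rintegral => w _; congr cos; rewrite /=; ring.
move=> H2.
rewrite (_ : t ^+ 2 / 2 = (b * t) ^+ 2 / 2 + (a * t) ^+ 2 / 2); last first.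
  by rewrite -[in LHS](mulr1 (t ^+ 2)) -ab; ring.
rewrite opprD expRD -mulrA.
set e1 := expR (- ((b * t) ^+ 2 / 2)) in H1 *.
set e2 := expR _ in H2 *.
have e1_le1 : e1 <= 1.
  by rewrite -expR0 ler_expR oppr_le0 mulr_ge0 ?sqr_ge0 ?invr_ge0.
have e1_ge0 : 0 <= e1 by exact: expR_ge0.
rewrite (_ : _ - _ = (J1 - e1 * J2) + e1 * (J2 - e2 * cos s)); last by ring.
apply: (le_trans (ler_normD _ _)).
rewrite [leRHS]mulrDl [leLHS]addrC; apply: lerD.
  rewrite normrM (ger0_norm e1_ge0).
  rewrite (_ : dU * `|a| ^+ 3 * `|t| ^+ 3 = dU * `|a * t| ^+ 3).
    by apply: le_trans H2; exact: ler_piMl.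
  by rewrite normrM exprMn [RHS]mulrA.
by rewrite normrM exprMn mulrA in H1.
Qed.

Lemma integrable_same_law (U V : {mfun T >-> R}) (f : R -> R) :
  same_law (P := P) (P' := P) U V -> measurable_fun setT f ->
  P.-integrable setT (EFin \o (f \o V)) ->
  P.-integrable setT (EFin \o (f \o U)).
Proof.
move=> UV mf /integrableP[_ h]; apply/integrableP; split.
  by apply/measurable_EFinP; exact: measurableT_comp.
have mg : measurable_fun setT (fun x => `|(f x)%:E|%E).
  by apply: measurableT_comp => //; exact/measurable_EFinP.
rewrite -(ge0_integral_distribution U mg)//.
rewrite (eq_measure_integral (distribution P V)); last by move=> A mA _; exact: UV.
by rewrite (ge0_integral_distribution V mg).
Qed.

Lemma Rintegral_same_law (U V : {mfun T >-> R}) (f : R -> R) :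
  same_law (P := P) (P' := P) U V -> measurable_fun setT f ->
  P.-integrable setT (EFin \o (f \o V)) ->
  \int[P]_w f (U w) = \int[P]_w f (V w).
Proof.
move=> UV mf fV; have fU := integrable_same_law U V f UV mf fV.
have mg : measurable_fun setT (fun x => (f x)%:E) by exact/measurable_EFinP.
rewrite /Rintegral -(integral_distribution mg fU) -(integral_distribution mg fV).
by congr fine; apply: eq_measure_integral => A mA _; exact: UV.
Qed.
End sums.

(** * Taylor remainders of the cosine *)
Section trig_estimates.
Context {R : realType}.
Implicit Types x y s : R.

Lemma mean_value_norm (f df : R -> R) x y : (forall z : R, is_derive z (1 : R) f (df z)) ->
  exists2 c, `|c| <= Num.max `|x| `|y| & f y - f x = df c * (y - x).
Proof.
move=> fd.
have fc : continuous f.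
  by move=> z; exact/differentiable_continuous/derivable1_diffP.
wlog xy : x y / x <= y => [H|].
  have [/H //|/ltW/H [c cxy e]] := leP x y.
  by exists c; [rewrite maxC|rewrite -[LHS]opprB e -mulrN opprB].
have [|c] := MVT_segment xy (fun z _ => fd z).
  exact: continuous_subspaceT.
rewrite in_itv/= => /andP[xc cy] ->; exists c => //.
rewrite le_max; apply/orP; have [c0|c0] := leP 0 c.
  by right; rewrite ger0_norm//; exact: le_trans cy (ler_norm y).
by left; rewrite ltr0_norm// -(normrN x) (le_trans _ (ler_norm _))// lerN2.
Qed.

Lemma norm_sin_le x : `|sin x| <= `|x|.
Proof.
have [c _] := mean_value_norm sin cos 0 x (fun z => is_derive_sin z).
rewrite sin0 !subr0 => ->; rewrite normrM ler_piMl//.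
by rewrite ler_norml cos_geN1 cos_le1.
Qed.

Lemma norm_cos_sub1_le x : `|cos x - 1| <= x ^+ 2.
Proof.
have [c] := mean_value_norm cos (fun z => - sin z) 0 x (fun z => is_derive_cos z).
rewrite normr0 max_r// cos0 subr0 => cx ->.
rewrite normrM normrN -(real_normK (num_real x)) expr2 ler_wpM2r//.
exact: le_trans (norm_sin_le c) cx.
Qed.

Lemma norm_cos_sub1_le_norm x : `|cos x - 1| <= `|x|.
Proof.
have [c _] := mean_value_norm cos (fun z => - sin z) 0 x (fun z => is_derive_cos z).
rewrite cos0 subr0 => ->; rewrite normrM normrN ler_piMl//.
by rewrite ler_norml sin_geN1 sin_le1.
Qed.

Definition cos_rem x := cos x - 1 + x ^+ 2 / 2.
Definition sin_rem x := sin x - x.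

Lemma is_derive_sin_rem (z : R) : is_derive z (1 : R) sin_rem (cos z - 1).
Proof. exact: is_deriveB. Qed.

Lemma norm_sin_rem_le x : `|sin_rem x| <= x ^+ 2.
Proof.
have [c] := mean_value_norm _ _ 0 x is_derive_sin_rem.
rewrite normr0 max_r// /sin_rem sin0 !subr0 => cx ->.
rewrite normrM -(real_normK (num_real x)) expr2 ler_wpM2r//.
exact: le_trans (norm_cos_sub1_le_norm c) cx.
Qed.

Lemma is_derive_cos_rem (z : R) : is_derive z (1 : R) cos_rem (- sin_rem z).
Proof.
rewrite (_ : cos_rem = (cos : R -> R) - cst 1 + 2^-1 \*: (id ^+ 2 : R -> R)); last first.
  by apply/funext => y; rewrite /cos_rem [in LHS](mulrC (y ^+ 2)).
apply: is_derive_eq; rewrite /sin_rem /= expr1 /GRing.scale/= mulr1.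
by field.
Qed.

Lemma max_sqr_le x y c : `|c| <= Num.max `|x| `|y| -> c ^+ 2 <= x ^+ 2 + y ^+ 2.
Proof.
rewrite le_max -(real_normK (num_real c)) -(real_normK (num_real x)) -(real_normK (num_real y)).
case/orP => h.
  by apply: ler_wpDr; rewrite ?sqr_ge0// ler_sqr// nnegrE.
by apply: ler_wpDl; rewrite ?sqr_ge0// ler_sqr// nnegrE.
Qed.

Lemma norm_sub_sin_rem_le x y :
  `|sin_rem x - sin_rem y| <= `|x - y| * (x ^+ 2 + y ^+ 2).
Proof.
have [c cxy ->] := mean_value_norm _ _ y x is_derive_sin_rem.
rewrite normrM mulrC ler_wpM2l// (le_trans (norm_cos_sub1_le c))//.
by rewrite addrC; exact: max_sqr_le.
Qed.

Lemma norm_sub_cos_rem_le x y :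
  `|cos_rem x - cos_rem y| <= `|x - y| * (x ^+ 2 + y ^+ 2).
Proof.
have [c cxy ->] := mean_value_norm _ _ y x is_derive_cos_rem.
rewrite normrM normrN mulrC ler_wpM2l// (le_trans (norm_sin_rem_le c))//.
by rewrite addrC; exact: max_sqr_le.
Qed.

(** Remainder of order two at 0 of [x |-> cos (x + s)].  For two variables with the
    same mean and variance, [cos_phase_rem] and [cos] have the same difference of
    expectations. *)
Definition cos_phase_rem s x := cos (x + s) - (cos s - x * sin s - x ^+ 2 / 2 * cos s).

Lemma cos_phase_remE s x : cos_phase_rem s x = cos_rem x * cos s - sin_rem x * sin s.
Proof. by rewrite /cos_phase_rem /cos_rem /sin_rem cosD; ring. Qed.

Lemma norm_sub_cos_phase_rem_le s x y :
  `|cos_phase_rem s x - cos_phase_rem s y| <= 2 * (`|x - y| * (x ^+ 2 + y ^+ 2)).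
Proof.
rewrite !cos_phase_remE.
rewrite (_ : _ - _ = (cos_rem x - cos_rem y) * cos s - (sin_rem x - sin_rem y) * sin s);
  last by ring.
rewrite (le_trans (ler_normB _ _))// mulr_natl mulr2n lerD// normrM.
  rewrite (le_trans _ (norm_sub_cos_rem_le x y))// ler_piMr//.
  by rewrite ler_norml cos_geN1 cos_le1.
rewrite (le_trans _ (norm_sub_sin_rem_le x y))// ler_piMr//.
by rewrite ler_norml sin_geN1 sin_le1.
Qed.

Lemma norm_cos_phase_rem_le s x : `|cos_phase_rem s x| <= 2 * `|x| ^+ 3.
Proof.
have := norm_sub_cos_phase_rem_le s x 0.
rewrite {2}/cos_phase_rem add0r mul0r expr0n /= mul0r !mul0r !subr0 subrr subr0 addr0.
by rewrite -(real_normK (num_real x)) -exprS.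
Qed.

Lemma norm_expR_rem_le x : `|expR (- (x ^+ 2 / 2)) - (1 - x ^+ 2 / 2)| <= `|x| ^+ 3.
Proof.
have e0 := expR_ge1Dx (- (x ^+ 2 / 2)).
have := expR_ge1Dx (x ^+ 2 / 2).
have := expRN (x ^+ 2 / 2).
have := expR_gt0 (x ^+ 2 / 2).
rewrite -!(real_normK (num_real x)) in e0 *.
have a0 := normr_ge0 x; set a := `|x| in a0 e0 *.
set u := a ^+ 2 / 2 in e0 *.
have u0 : 0 <= u by rewrite mulr_ge0 ?sqr_ge0 ?invr_ge0.
set E := expR u in e0 *; set F := expR (- u) in e0 *.
move=> E0 FE E1.
have F0 : 0 < F by exact: expR_gt0.
have H1 : F * (1 + u) <= 1.
  by rewrite FE mulrC ler_pdivrMr// mul1r.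
have F1 : F <= 1.
  by apply: le_trans H1; rewrite ler_peMr ?(ltW F0)// lerDl.
rewrite ger0_norm; last by rewrite subr_ge0.
have [a1|a1] := leP a 1.
  have H2 : F <= 1 - u + u ^+ 2.
    have u1 : 0 < 1 + u by rewrite ltr_wpDr.
    rewrite -(ler_pM2r u1); apply: (le_trans H1).
    rewrite (_ : _ * (1 + u) = 1 + u ^+ 3); last by ring.
    by rewrite lerDl exprn_ge0.
  have : u ^+ 2 <= a ^+ 3.
    rewrite (_ : u ^+ 2 = a ^+ 3 * (a / 4)); last by rewrite /u; field.
    by rewrite ler_piMr ?exprn_ge0//; lra.
  by lra.
have : a ^+ 2 <= a ^+ 3 by rewrite ler_weXn2l// ltW.
have := sqr_ge0 a; rewrite /u in F1 *; lra.
Qed.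
End trig_estimates.

(** * Centred variables with a fourth moment *)
Section moments.
Context {d : measure_display} {T : measurableType d} {R : realType}.
Variable P : probability T R.

Record centered4 (W : T -> R) (v : R) : Prop := {
  c4_meas : measurable_fun setT W ;
  c4_int : P.-integrable setT (EFin \o (fun w => W w ^+ 4)) ;
  c4_mean : \int[P]_w W w = 0 ;
  c4_var : \int[P]_w W w ^+ 2 = v
}.

Lemma integrable_le4 (W f : T -> R) :
  P.-integrable setT (EFin \o (fun w => W w ^+ 4)) -> measurable_fun setT f ->
  (forall w, `|f w| <= 1 + W w ^+ 4) -> P.-integrable setT (EFin \o f).
Proof.
move=> W4 mf fW; apply: (integrable_dominated P _ (fun w => 1 + W w ^+ 4)) => //.
by apply: integrable_add => //; exact: integrable_cst.
Qed.

Lemma norm_le_1Dfourth (x : R) : `|x| <= 1 + x ^+ 4.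
Proof.
have -> : x ^+ 4 = `|x| ^+ 4 by rewrite -normrX ger0_norm// (exprM x 2 2) sqr_ge0.
have := normr_ge0 x; set y := `|x| => y0.
have [y1|y1] := leP y 1; first by have := exprn_ge0 4 y0; lra.
have : y <= y ^+ 4 by rewrite ler_eXnr// ltW.
lra.
Qed.

Lemma sqr_le_1Dfourth (x : R) : `|x ^+ 2| <= 1 + x ^+ 4.
Proof.
by rewrite ger0_norm ?sqr_ge0// (exprM x 2 2); have := sqr_ge0 (x ^+ 2 - 1); have := sqr_ge0 (x ^+ 2); nra.
Qed.

Lemma cube_le_1Dfourth (x : R) : `|x| ^+ 3 <= 1 + x ^+ 4.
Proof.
have -> : x ^+ 4 = `|x| ^+ 4 by rewrite -normrX ger0_norm// (exprM x 2 2) sqr_ge0.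
have := normr_ge0 x; set y := `|x| => y0.
have [y1|y1] := leP y 1.
  have y4 := exprn_ge0 4 y0; have y3 : y ^+ 3 <= 1 by exact: exprn_ile1.
  lra.
have : y ^+ 3 <= y ^+ 4 by rewrite ler_weXn2l// ltW.
lra.
Qed.

Lemma integrable1_of4 (W : T -> R) : measurable_fun setT W ->
  P.-integrable setT (EFin \o (fun w => W w ^+ 4)) -> P.-integrable setT (EFin \o W).
Proof.
by move=> mW W4; apply: (integrable_le4 W) => // w; exact: norm_le_1Dfourth.
Qed.

Lemma integrable2_of4 (W : T -> R) : measurable_fun setT W ->
  P.-integrable setT (EFin \o (fun w => W w ^+ 4)) ->
  P.-integrable setT (EFin \o (fun w => W w ^+ 2)).
Proof.
move=> mW W4; apply: (integrable_le4 W) => // [|w]; last exact: sqr_le_1Dfourth.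
exact: measurable_funX.
Qed.

Lemma integrableM_of4 (W U : T -> R) : measurable_fun setT W -> measurable_fun setT U ->
  P.-integrable setT (EFin \o (fun w => W w ^+ 4)) ->
  P.-integrable setT (EFin \o (fun w => U w ^+ 4)) ->
  P.-integrable setT (EFin \o (fun w => W w * U w)).
Proof.
move=> mW mU W4 U4.
apply: (integrable_dominated P _ (fun w => W w ^+ 2 + U w ^+ 2)).
- exact: measurable_funM.
- move=> w; rewrite ler_norml; apply/andP; split.
    by have := sqr_ge0 (W w + U w); have := sqr_ge0 (W w); have := sqr_ge0 (U w); nra.
  by have := sqr_ge0 (W w - U w); have := sqr_ge0 (W w); have := sqr_ge0 (U w); nra.
- by apply: integrable_add; exact: integrable2_of4.
Qed.

Lemma fourth_add_le (x y : R) : (x + y) ^+ 4 <= 8 * x ^+ 4 + 8 * y ^+ 4.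
Proof.
rewrite !(exprM _ 2 2).
have h1 : (x + y) ^+ 2 <= 2 * (x ^+ 2 + y ^+ 2) by have := sqr_ge0 (x - y); nra.
have h0 := sqr_ge0 (x + y); have := sqr_ge0 x; have := sqr_ge0 y.
move: h1 h0; move: (x ^+ 2) (y ^+ 2) ((x + y) ^+ 2) => a b c h1 h0 b0 a0.
have : c ^+ 2 <= (2 * (a + b)) ^+ 2 by rewrite ler_sqr ?nnegrE//; lra.
by have := sqr_ge0 (a - b); nra.
Qed.

Lemma integrable4_add (W U : T -> R) : measurable_fun setT W -> measurable_fun setT U ->
  P.-integrable setT (EFin \o (fun w => W w ^+ 4)) ->
  P.-integrable setT (EFin \o (fun w => U w ^+ 4)) ->
  P.-integrable setT (EFin \o (fun w => (W w + U w) ^+ 4)).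
Proof.
move=> mW mU W4 U4.
apply: (integrable_dominated P _ (fun w => 8 * W w ^+ 4 + 8 * U w ^+ 4)).
- by apply: measurable_funX; exact: measurable_funD.
- move=> w; rewrite ger0_norm ?fourth_add_le//.
  by rewrite (exprM _ 2 2) sqr_ge0.
- by apply: integrable_add; exact: integrable_scale.
Qed.

Lemma Rintegral_cos_phase_rem (W : T -> R) (t s : R) : centered4 W 1 ->
  P.-integrable setT (EFin \o (fun w => cos_phase_rem s (t * W w))) /\
  \int[P]_w cos_phase_rem s (t * W w) =
  \int[P]_w cos (t * W w + s) - (1 - t ^+ 2 / 2) * cos s.
Proof.
move=> [mW W4 W1 W2].
have iW := integrable1_of4 W mW W4; have iW2 := integrable2_of4 W mW W4.
have ic := integrable_cos_affine P W t s mW.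
have iq : P.-integrable setT (EFin \o
   (fun w => cos s - (t * sin s) * W w - (t ^+ 2 / 2 * cos s) * W w ^+ 2)).
  apply: integrable_sub; last exact: integrable_scale.
  by apply: integrable_sub; [exact: integrable_cst|exact: integrable_scale].
have -> : (fun w => cos_phase_rem s (t * W w)) = (fun w => cos (t * W w + s) -
   (cos s - (t * sin s) * W w - (t ^+ 2 / 2 * cos s) * W w ^+ 2)).
  by apply/funext => w; rewrite /cos_phase_rem; congr (_ - _); field.
split; first exact: integrable_sub.
rewrite RintegralB//; congr (_ - _).
rewrite RintegralB//; [|by apply: integrable_sub; [exact: integrable_cst|exact: integrable_scale]
  |exact: integrable_scale].
rewrite RintegralB//; [|exact: integrable_cst|exact: integrable_scale].
by rewrite !RintegralZl// W1 W2 Rintegral_cst_prob; ring.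
Qed.

(** The constant is not small: the bound serves for the finitely many indices at
    which the contraction has not yet set in. *)
Lemma gauss_close_crude (W : T -> R) : centered4 W 1 ->
  gauss_close P W (2 * (1 + \int[P]_w W w ^+ 4) + 1).
Proof.
move=> cW t s; have [iR eR] := Rintegral_cos_phase_rem W t s cW.
have [mW W4 _ _] := cW.
rewrite (_ : _ - _ = \int[P]_w cos_phase_rem s (t * W w)
   - (expR (- (t ^+ 2 / 2)) - (1 - t ^+ 2 / 2)) * cos s); last by rewrite eR; ring.
rewrite (le_trans (ler_normB _ _))// [leRHS]mulrDl lerD//; last first.
  rewrite mul1r (le_trans _ (norm_expR_rem_le t))// normrM ler_piMr//.
  by rewrite ler_norml cos_geN1 cos_le1.
have i1 : P.-integrable setT (EFin \o (fun w => 2 * `|t| ^+ 3 * (1 + W w ^+ 4))).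
  by apply: integrable_scale; apply: integrable_add => //; exact: integrable_cst.
apply: (le_trans (le_normr_Rintegral _ _)) => //.
apply: (@le_trans _ _ (\int[P]_w (2 * `|t| ^+ 3 * (1 + W w ^+ 4)))).
  apply: le_Rintegral => //; first exact: integrable_norm.
  move=> w _; rewrite (le_trans (norm_cos_phase_rem_le _ _))//.
  rewrite normrM exprMn mulrA ler_wpM2l ?mulr_ge0 ?exprn_ge0//.
  exact: cube_le_1Dfourth.
rewrite RintegralZl//; last by apply: integrable_add => //; exact: integrable_cst.
rewrite RintegralD//; last exact: integrable_cst.
by rewrite Rintegral_cst_prob mulrAC.
Qed.

(** The remainders of [W] and [U] differ by at most
    [2 |t|^3 |W - U| (W^2 + U^2)], and [x * y <= x ^+ 2 / e + e * y ^+ 2] splits the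
    product.  The weight [e] is free because the L2 distance is small while the
    fourth moments may be large; it balances the two. *)
Lemma gauss_close_perturb (W U : T -> R) (delta A M e : R) :
  centered4 W 1 -> centered4 U 1 -> 0 < e ->
  \int[P]_w (W w - U w) ^+ 2 <= A ->
  \int[P]_w W w ^+ 4 <= M -> \int[P]_w U w ^+ 4 <= M ->
  gauss_close P U delta ->
  gauss_close P W (delta + 2 * (A / e + 4 * e * M)).
Proof.
move=> cW cU e0 WUA WM UM Ud t s.
have [iW eW] := Rintegral_cos_phase_rem W t s cW.
have [iU eU] := Rintegral_cos_phase_rem U t s cU.
have [mW W4 _ _] := cW; have [mU U4 _ _] := cU.
have iWU2 : P.-integrable setT (EFin \o (fun w => (W w - U w) ^+ 2)).
  apply: integrable2_of4; first exact: measurable_funB.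
  have -> : (fun w => (W w - U w) ^+ 4) = (fun w => (W w + (-1) * U w) ^+ 4).
    by apply/funext => w; rewrite mulN1r.
  apply: integrable4_add => //; first exact: measurable_funM.
  under [X in _.-integrable _ X]eq_fun do rewrite /= exprMn -signr_odd /= expr0 mul1r.
  exact: U4.
rewrite (_ : _ - _ = (\int[P]_w cos (t * U w + s) - expR (- (t ^+ 2 / 2)) * cos s)
  + (\int[P]_w cos_phase_rem s (t * W w) - \int[P]_w cos_phase_rem s (t * U w)));
  last by rewrite eW eU; ring.
rewrite (le_trans (ler_normD _ _))// [leRHS]mulrDl lerD//.
rewrite -RintegralB//.
pose B w := 2 * `|t| ^+ 3 * (e^-1 * (W w - U w) ^+ 2 + 2 * e * (W w ^+ 4 + U w ^+ 4)).
have iin : P.-integrable setT (EFin \o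
   (fun w => e^-1 * (W w - U w) ^+ 2 + 2 * e * (W w ^+ 4 + U w ^+ 4))).
  apply: integrable_add; first exact: integrable_scale.
  by apply: integrable_scale; exact: integrable_add.
apply: (le_trans (le_normr_Rintegral _ _)) => //; first exact: integrable_sub.
apply: (@le_trans _ _ (\int[P]_w B w)).
  apply: le_Rintegral => //.
  - by apply: integrable_norm; exact: integrable_sub.
  - exact: integrable_scale.
  move=> w _; rewrite (le_trans (norm_sub_cos_phase_rem_le _ _ _))//.
  rewrite /B -mulrBr normrM !exprMn -mulrDr -(real_normK (num_real t)).
  rewrite (_ : 2 * _ = 2 * `|t| ^+ 3 * (`|W w - U w| * (W w ^+ 2 + U w ^+ 2))); last by ring.
  rewrite ler_wpM2l ?mulr_ge0 ?exprn_ge0//.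
  rewrite -(real_normK (num_real (W w - U w))) !(exprM _ 2 2).
  have := sqr_ge0 (W w); have := sqr_ge0 (U w); have := normr_ge0 (W w - U w).
  move: (`|_|) (W w ^+ 2) (U w ^+ 2) => x a b x0 b0 a0.
  have : e * (e^-1 * x ^+ 2 + 2 * e * (a ^+ 2 + b ^+ 2) - x * (a + b)) >= 0.
    rewrite (_ : e * _ = x ^+ 2 + 2 * e ^+ 2 * (a ^+ 2 + b ^+ 2) - x * (e * (a + b))); last first.
      by field; rewrite gt_eqF.
    have := sqr_ge0 (x - e * (a + b)); have := sqr_ge0 (e * (a - b)).
    have := sqr_ge0 x; have := sqr_ge0 (e * (a + b)).
    nra.
  by rewrite pmulr_rge0// subr_ge0.
rewrite /B RintegralZl// RintegralD//; last first.
- by apply: integrable_scale; exact: integrable_add.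
- exact: integrable_scale.
rewrite !RintegralZl//; last exact: integrable_add.
rewrite RintegralD// [leRHS]mulrAC ler_wpM2l ?mulr_ge0 ?exprn_ge0//.
apply: lerD; first by rewrite mulrC ler_wpM2r// invr_ge0 ltW.
rewrite (_ : 4 * e * M = 2 * e * (M + M)); last by ring.
by rewrite ler_wpM2l ?lerD// mulr_ge0// ltW.
Qed.

(** With [c] the expectation of [W * U], the two sides of the hypothesis and of the
    conclusion are [p^2 + q^2 - 2 p q c] and [2 - 2 c]; their comparison is
    [0 <= (p - q)^2].  The scales [p] and [q] may thus be far apart. *)
Lemma Rintegral_sqr_dist_le (W U : T -> R) (p q v : R) :
  centered4 W 1 -> centered4 U 1 -> 0 < p -> 0 < q ->
  \int[P]_w (p * W w - q * U w) ^+ 2 <= v ->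
  \int[P]_w (W w - U w) ^+ 2 <= v / (p * q).
Proof.
move=> [mW W4 _ W2] [mU U4 _ U2] p0 q0.
have iW2 := integrable2_of4 W mW W4; have iU2 := integrable2_of4 U mU U4.
have iWU := integrableM_of4 W U mW mU W4 U4.
have E (x y : R) : \int[P]_w (x * W w - y * U w) ^+ 2 =
   x ^+ 2 + y ^+ 2 - 2 * x * y * \int[P]_w (W w * U w).
  have -> : (fun w => (x * W w - y * U w) ^+ 2) = (fun w =>
    (x ^+ 2 * W w ^+ 2 + y ^+ 2 * U w ^+ 2) - 2 * x * y * (W w * U w)).
    by apply/funext => w; ring.
  rewrite RintegralB//; [|by apply: integrable_add; exact: integrable_scale
    |exact: integrable_scale].
  rewrite RintegralD//; [|exact: integrable_scale..].
  by rewrite !RintegralZl// W2 U2 !mulr1.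
rewrite E => H; rewrite ler_pdivlMr ?mulr_gt0//; apply: le_trans H.
have := E 1 1; under eq_Rintegral do rewrite !mul1r.
by move=> ->; have := sqr_ge0 (p - q); nra.
Qed.
End moments.

Section moments_of_sums.
Context {d : measure_display} {T : measurableType d} {R : realType}.
Variable P : probability T R.

Lemma Rintegral_indep_pair_mul (U V : {mfun T >-> R}) :
  indep_pair P U V ->
  P.-integrable setT (EFin \o (fun w => U w ^+ 4)) ->
  P.-integrable setT (EFin \o (fun w => V w ^+ 4)) ->
  \int[P]_w (U w * V w) = (\int[P]_w U w) * \int[P]_w V w.
Proof.
move=> UV U4 V4.
have iU : P.-integrable setT (EFin \o U) by exact: integrable1_of4.
have iV : P.-integrable setT (EFin \o V) by exact: integrable1_of4.
rewrite (integral_indep_pair P U V (fun x y => x * y))//.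
- by under eq_Rintegral do rewrite RintegralZl//; rewrite RintegralZr.
- by apply: measurable_funM; [exact: measurable_fst|exact: measurable_snd].
- exact: integrableM_of4.
- by move=> u; exact: integrable_scale.
Qed.

Lemma centered4_scale (W : T -> R) (c v : R) : centered4 P W v ->
  centered4 P (fun w => c * W w) (c ^+ 2 * v).
Proof.
move=> [mW W4 W1 W2]; split.
- exact: measurable_funM.
- by under [X in _.-integrable _ X]eq_fun do rewrite /= exprMn; exact: integrable_scale.
- by rewrite RintegralZl// ?W1 ?mulr0//; exact: integrable1_of4.
- under eq_Rintegral do rewrite exprMn.
  by rewrite RintegralZl// ?W2//; exact: integrable2_of4.
Qed.

Lemma centered4_add (U V : {mfun T >-> R}) (u v : R) :
  indep_pair P U V -> centered4 P U u -> centered4 P V v ->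
  centered4 P (fun w => U w + V w) (u + v).
Proof.
move=> UV [mU U4 U1 U2] [mV V4 V1 V2].
have iU := integrable1_of4 P U mU U4; have iV := integrable1_of4 P V mV V4.
have iU2 := integrable2_of4 P U mU U4; have iV2 := integrable2_of4 P V mV V4.
have iUV := integrableM_of4 P U V mU mV U4 V4.
split.
- exact: measurable_funD.
- exact: integrable4_add.
- by rewrite RintegralD// U1 V1 addr0.
- have -> : (fun w => (U w + V w) ^+ 2) = (fun w => (U w ^+ 2 + V w ^+ 2) + 2 * (U w * V w)).
    by apply/funext => w; ring.
  rewrite RintegralD//; [|exact: integrable_add|exact: integrable_scale].
  rewrite RintegralD// RintegralZl// U2 V2 Rintegral_indep_pair_mul// U1 mul0r; ring.
Qed.

Lemma fourth_moment_add (U V : T -> R) (M N : R) :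
  measurable_fun setT U -> measurable_fun setT V ->
  P.-integrable setT (EFin \o (fun w => U w ^+ 4)) ->
  P.-integrable setT (EFin \o (fun w => V w ^+ 4)) ->
  \int[P]_w U w ^+ 4 <= M -> \int[P]_w V w ^+ 4 <= N ->
  \int[P]_w (U w + V w) ^+ 4 <= 8 * M + 8 * N.
Proof.
move=> mU mV U4 V4 UM VN.
apply: (@le_trans _ _ (\int[P]_w (8 * U w ^+ 4 + 8 * V w ^+ 4))).
  apply: le_Rintegral => //.
  - exact: integrable4_add.
  - by apply: integrable_add; exact: integrable_scale.
  by move=> w _; exact: fourth_add_le.
rewrite RintegralD//; [|exact: integrable_scale..].
by rewrite !RintegralZl//; apply: lerD; rewrite ler_wpM2l.
Qed.

Lemma centered4_lincomb (I : finType) (U : I -> {mfun T >-> R}) (c : I -> R)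
    (r : seq I) :
  mutually_independent (P := P) U -> (forall i, centered4 P (U i) 1) -> uniq r ->
  centered4 P (fun w => \sum_(i <- r) c i * U i w) (\sum_(i <- r) c i ^+ 2).
Proof.
move=> indU U4; elim: r => [_|i r IH /= /andP[ir ur]].
  rewrite big_nil; under eq_fun do rewrite big_nil.
  split; [exact: measurable_cst|..].
  - by rewrite (_ : (fun=> _) = fun=> 0); [exact: integrable_cst|by apply/funext => w; rewrite expr0n].
  - exact: Rintegral_cst_prob.
  - by under eq_Rintegral do rewrite expr0n/=; exact: Rintegral_cst_prob.
have ci := centered4_scale (U i) (c i) 1 (U4 i); rewrite mulr1 in ci.
rewrite big_cons addrC.
under eq_fun do rewrite big_cons addrC.
pose V := mfun_of _ (measurable_lincomb I U c r).
pose W := mfun_of _ (c4_meas _ _ _ ci).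
apply: (centered4_add V W) => //; last exact: IH.
apply: (indep_pair_comp P V (U i) idfun (fun x => c i * x)) => //.
- exact: measurable_id.
- exact: measurable_funM.
exact: indep_pair_sum.
Qed.

Lemma fourth_moment_lincomb (I : finType) (U : I -> {mfun T >-> R}) (c : I -> R)
    (r : seq I) (M : R) :
  (forall i, `|c i| <= 1) -> (forall i, centered4 P (U i) 1) ->
  (forall i, \int[P]_w U i w ^+ 4 <= M) ->
  P.-integrable setT (EFin \o (fun w => (\sum_(i <- r) c i * U i w) ^+ 4)) /\
  \int[P]_w (\sum_(i <- r) c i * U i w) ^+ 4 <= 8 ^+ size r * (size r)%:R * M.
Proof.
move=> c1 U4 UM.
elim: r => [|i r [IH1 IH2]].
  under [X in _.-integrable _ X]eq_fun do rewrite /= big_nil expr0n/=.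
  under eq_Rintegral do rewrite big_nil expr0n/=.
  by rewrite Rintegral_cst_prob mulr0 mul0r; split => //; exact: integrable_cst.
have M0 : 0 <= M.
  by apply: le_trans (UM i); apply: Rintegral_ge0 => w _; rewrite (exprM _ 2 2) sqr_ge0.
have [mUi Ui4 _ _] := U4 i.
have ci4 : P.-integrable setT (EFin \o (fun w => (c i * U i w) ^+ 4)).
  by under [X in _.-integrable _ X]eq_fun do rewrite /= exprMn; exact: integrable_scale.
have mci : measurable_fun setT (fun w => c i * U i w) by exact: measurable_funM.
have mr := measurable_lincomb I U c r.
under [X in _.-integrable _ X]eq_fun do rewrite /= big_cons.
under eq_Rintegral do rewrite big_cons.
split; first exact: integrable4_add.
have ciM : \int[P]_w (c i * U i w) ^+ 4 <= M.
  under eq_Rintegral do rewrite exprMn.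
  rewrite RintegralZl//; apply: le_trans (UM i); apply: ler_piMl.
    by apply: Rintegral_ge0 => w _; rewrite (exprM _ 2 2) sqr_ge0.
  by rewrite -(ger0_norm (_ : 0 <= c i ^+ 4)) ?normrX ?exprn_ile1// (exprM _ 2 2) sqr_ge0.
apply: (le_trans (fourth_moment_add _ _ _ _ mci mr ci4 IH1 ciM IH2)).
rewrite [leRHS](_ : _ = 8 ^+ size r * (8 * M) + 8 * (8 ^+ size r * (size r)%:R * M)).
  by rewrite lerD2r ler_peMl ?exprn_ege1 ?ler1n// mulr_ge0.
by rewrite /= exprS -natr1; ring.
Qed.
End moments_of_sums.

(** * The normal density *)
Section integral_of_derivative.
Context {R : realType}.
Notation mu := (@lebesgue_measure R).

(** Fundamental theorem of calculus from [- n] to [n], then dominated convergence. *)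
Lemma Rintegral_derivative (G g : R -> R) :
  (forall x : R, is_derive x (1 : R) G (g x)) -> continuous g ->
  mu.-integrable setT (EFin \o g) ->
  G n%:R @[n --> \oo] --> (0 : R) -> G (- n%:R) @[n --> \oo] --> (0 : R) ->
  \int[mu]_x g x = 0.
Proof.
move=> dG cg ig Gy GNy.
have mg : measurable_fun setT g by exact: continuous_measurable_fun.
pose f_ n := (EFin \o g) \_ `[(- n%:R : R), n%:R].
have dc := @dominated_convergence _ _ _ mu setT measurableT f_ (EFin \o g)
  (abse \o (EFin \o g)).
have [||||| _ _ cv] := dc.
- move=> n; apply/(measurable_restrictT _ _).1 => //.
  by apply: measurable_funTS; exact/measurable_EFinP.
- exact/measurable_EFinP.
- apply: aeW => x _; apply: cvg_near_cst.
  near=> n; rewrite /f_ patchE ifT// inE/= in_itv/= -ler_norml.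
  by near: n; exact: nbhs_infty_ger.
- exact: integrable_abse.
- apply: aeW => x n _; rewrite /f_ patchE; case: ifPn => // _; rewrite ?abse_id //.
  by change (`|0| <= `|(g x)%:E|)%E; rewrite abse0 abse_ge0.
have E n : (0 < n)%N -> (\int[mu]_x f_ n x = (G n%:R - G (- n%:R))%:E)%E.
  move=> n0; rewrite -integral_mkcond.
  rewrite (@continuous_FTC2 _ g G)//.
  - by rewrite gtrN// ltr0n.
  - exact: continuous_subspaceT.
  - have cG : continuous G by move=> x; exact/differentiable_continuous/derivable1_diffP.
    split; first by move=> x _; exact: ex_derive.
    + by apply: cvg_at_right_filter; exact: cG.
    + by apply: cvg_at_left_filter; exact: cG.
  - by move=> x _; rewrite derive1E derive_val.
have cv0 : (\int[mu]_x f_ n x @[n --> \oo] --> (0%:E : \bar R))%E.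
  have : (G n%:R - G (- n%:R))%:E @[n --> \oo] --> (0%:E : \bar R).
    by apply/fine_cvgP; split; [exact: nearW|rewrite -[X in _ --> X](subr0 0); exact: cvgB].
  apply: cvg_trans; apply: near_eq_cvg; near=> n.
  by rewrite E//; near: n; exact: nbhs_infty_gt.
by rewrite /Rintegral (cvg_unique _ cv cv0).
Unshelve. all: by end_near. Qed.
End integral_of_derivative.

Section normal_density.
Context {R : realType}.
Notation mu := (@lebesgue_measure R).

(** Moments and tails of a normal law are all read off from this identity: the
    Gaussian factor absorbs polynomials, and the wider density has integral 1. *)
Lemma normal_pdf_wider (m s x : R) : 0 < s ->
  normal_pdf m s x = 2 * expR (- (3 / 8 * ((x - m) / s) ^+ 2)) * normal_pdf m (2 * s) x.
Proof.
move=> s0.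
have s20 : 2 * s != 0 by rewrite mulf_neq0// gt_eqF.
rewrite normal_pdfE ?gt_eqF// normal_pdfE// /normal_peak.
rewrite (_ : (2 * s) ^+ 2 * pi *+ 2 = 2 ^+ 2 * (s ^+ 2 * pi *+ 2)); last by ring.
rewrite sqrtrM ?exprn_ge0// sqrtr_sqr ger0_norm// invfM /normal_fun.
set p := (Num.sqrt _)^-1.
rewrite (_ : - (x - m) ^+ 2 / (s ^+ 2 *+ 2) = - (3 / 8 * ((x - m) / s) ^+ 2) +
   - (x - m) ^+ 2 / ((2 * s) ^+ 2 *+ 2)); last by field; rewrite gt_eqF.
by rewrite expRD; field.
Qed.

Lemma normal_peak_le (s : R) : 0 < s -> normal_peak s <= s^-1.
Proof.
move=> s0; rewrite /normal_peak lef_pV2 ?posrE ?sqrtr_gt0//; last first.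
  by rewrite mulrn_wgt0// mulr_gt0 ?pi_gt0 ?exprn_gt0.
rewrite -[leLHS]ger0_norm ?(ltW s0)// -sqrtr_sqr ler_wsqrtr//.
apply: (@le_trans _ _ (s ^+ 2 * pi)).
  by rewrite ler_peMr ?sqr_ge0// (le_trans _ (pi_ge2 R))// ler1n.
by rewrite mulr2n lerDl mulr_ge0 ?sqr_ge0 ?pi_ge0.
Qed.

Lemma expR_ge_sqr (y : R) : 0 <= y -> y ^+ 2 <= 2 * expR y.
Proof.
move=> y0; have := expR_ge1Dxn 1 y0; rewrite (_ : 2`! = 2)%N// => h; lra.
Qed.

(** Hence whatever is bounded by [(1 + x ^+ 4)] times the density is integrable. *)
Lemma fourth_normal_pdf_le (x : R) :
  (1 + x ^+ 4) * normal_pdf 0 1 x <= 40 * normal_pdf 0 2 x.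
Proof.
rewrite (normal_pdf_wider 0 1)// mulr1 subr0 divr1.
set y := 3 / 8 * x ^+ 2.
have y0 : 0 <= y by rewrite mulr_ge0// sqr_ge0.
have e1 : y ^+ 2 <= 2 * expR y by exact: expR_ge_sqr.
have e2 : 1 <= expR y by rewrite -expR0 ler_expR.
have e0 := expR_gt0 y.
rewrite !mulrA ler_wpM2r ?normal_pdf_ge0// expRN ler_pdivrMr//.
rewrite (_ : x ^+ 4 = 64 / 9 * y ^+ 2); last by rewrite /y; field.
lra.
Qed.

Lemma measurable_dist_gt (m h : R) : measurable [set x : R | h < `|x - m|].
Proof.
have -> : [set x : R | h < `|x - m|] = setT `&` (fun x : R => `|x - m|) @^-1` `]h, +oo[.
  by rewrite setTI; apply/seteqP; split => x /=; rewrite in_itv/= andbT.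
have mf : measurable_fun setT (fun x : R => `|x - m|).
  by apply: measurableT_comp => //; exact: measurable_funB.
exact: mf.
Qed.

Lemma normal_tail_le (m s h : R) : 0 < s -> 0 < h ->
  (normal_prob m s [set x : R | (h < `|x - m|)%R] <= (16 / 3 * (s / h) ^+ 2)%R%:E)%E.
Proof.
move=> s0 h0; rewrite /normal_prob.
pose c := 16 / 3 * (s / h) ^+ 2.
have mT := measurable_dist_gt m h.
apply: (@le_trans _ _ (\int[mu]_(x in [set x : R | (h < `|x - m|)%R]) (c * normal_pdf m (2 * s) x)%R%:E)%E).
  apply: ge0_le_integral => //.
  - by move=> x _; rewrite lee_fin normal_pdf_ge0.
  - by apply/measurable_EFinP/measurable_funTS; exact: measurable_normal_pdf.
  - apply/measurable_EFinP/measurable_funTS; apply: measurable_funM => //.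
    exact: measurable_normal_pdf.
  - move=> x /= hx; rewrite lee_fin normal_pdf_wider// ler_wpM2r ?normal_pdf_ge0//.
    have xm0 : x - m != 0 by rewrite -normr_gt0 (lt_trans h0).
    have sn0 : s != 0 by rewrite gt_eqF.
    have r0 : 0 < ((x - m) / s) ^+ 2.
      by rewrite exprn_even_gt0//= mulf_neq0// invr_eq0.
    rewrite expRN.
    apply: (@le_trans _ _ (2 * (3 / 8 * ((x - m) / s) ^+ 2)^-1)).
      rewrite ler_wpM2l// lef_pV2 ?posrE ?expR_gt0//; last by rewrite mulr_gt0.
      by apply: le_trans (expR_ge1Dx _); rewrite lerDr.
    rewrite /c (_ : 2 * _ = 16 / 3 * (s ^+ 2 / (x - m) ^+ 2)); last first.
      by field; rewrite xm0 sn0.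
    rewrite exprMn exprVn ler_wpM2l// ler_wpM2l ?sqr_ge0//.
    rewrite lef_pV2; [|by rewrite posrE exprn_even_gt0|by rewrite posrE exprn_gt0].
    by rewrite -(real_normK (num_real (x - m))) ler_sqr ?nnegrE ?(ltW h0)// ltW.
have c0 : 0 <= c by rewrite mulr_ge0// sqr_ge0.
under eq_integral do rewrite EFinM.
rewrite ge0_integralZl//; last first.
- by move=> x _; rewrite lee_fin normal_pdf_ge0.
- by apply/measurable_EFinP/measurable_funTS; exact: measurable_normal_pdf.
rewrite -[leRHS]mule1 lee_wpmul2l//.
exact: (@probability_le1 _ _ _ (normal_prob m (2 * s))).
Qed.

End normal_density.

Section normal_characteristic_function.
Context {R : realType}.
Notation mu := (@lebesgue_measure R).
Notation phi := (@normal_pdf R 0 1).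

Lemma normal_pdf01E (x : R) : phi x = normal_peak 1 * expR (- (x ^+ 2 / 2)).
Proof.
rewrite normal_pdfE// /normal_fun; congr (_ * expR _).
by rewrite subr0 expr1n mulNr.
Qed.

Lemma is_derive_cos_affine (x s t : R) :
  is_derive t (1 : R) (fun u => cos (u * x + s)) (- (x * sin (t * x + s))).
Proof.
pose g : R -> R := x \*: (id : R -> R) + cst s.
have gE u : g u = u * x + s by rewrite /g !fctE /= [_ *: _]mulrC.
have dg : is_derive t (1 : R) g x.
  by apply: is_derive_eq; rewrite addr0 /GRing.scale/= mulr1.
rewrite (_ : (fun u => _) = cos \o g); last by apply/funext => u /=; rewrite gE.
have h : is_derive t (1 : R) (cos \o g) (- sin (g t) * x) by exact: is_derive1_comp.
apply: (is_derive_eq h).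
by rewrite gE mulNr mulrC.
Qed.

Lemma is_derive_sin_affine (x s t : R) :
  is_derive t (1 : R) (fun u => sin (u * x + s)) (x * cos (t * x + s)).
Proof.
pose g : R -> R := x \*: (id : R -> R) + cst s.
have gE u : g u = u * x + s by rewrite /g !fctE /= [_ *: _]mulrC.
have dg : is_derive t (1 : R) g x.
  by apply: is_derive_eq; rewrite addr0 /GRing.scale/= mulr1.
rewrite (_ : (fun u => _) = sin \o g); last by apply/funext => u /=; rewrite gE.
have h : is_derive t (1 : R) (sin \o g) (cos (g t) * x) by exact: is_derive1_comp.
apply: (is_derive_eq h).
by rewrite gE mulrC.
Qed.

Lemma is_derive_expR_sqr (x : R) :
  is_derive x (1 : R) (fun y => expR (- (y ^+ 2 / 2))) (- x * expR (- (x ^+ 2 / 2))).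
Proof.
pose g : R -> R := (- 2^-1) \*: (id ^+ 2 : R -> R).
have gE u : g u = - (u ^+ 2 / 2) by rewrite /g !fctE /= /GRing.scale/= mulNr mulrC.
have dg : is_derive x (1 : R) g (- x).
  apply: is_derive_eq; rewrite expr1 /GRing.scale/= mulr1; by field.
rewrite (_ : (fun u => _) = expR \o g); last by apply/funext => u /=; rewrite gE.
have h : is_derive x (1 : R) (expR \o g) (expR (g x) * - x) by exact: is_derive1_comp.
apply: (is_derive_eq h).
by rewrite gE mulrC.
Qed.

Lemma is_derive_normal_pdf (x : R) : is_derive x (1 : R) phi (- (x * phi x)).
Proof.
rewrite (_ : phi = normal_peak 1 \*: (fun y => expR (- (y ^+ 2 / 2)))); last first.
  by apply/funext => y; rewrite normal_pdf01E.
have h := is_derive_expR_sqr x.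
by apply: is_derive_eq; rewrite /GRing.scale/= mulNr mulrN mulrCA.
Qed.

Lemma integrable_le_normal (C : R) (f : R -> R) : measurable_fun setT f ->
  (forall x, `|f x| <= C * ((1 + x ^+ 4) * phi x)) -> 0 <= C ->
  mu.-integrable setT (EFin \o f).
Proof.
move=> mf fC C0.
have := integrable_dominated mu f (fun x => C * 40 * normal_pdf 0 2 x) mf. apply => //.
  move=> x; apply: (le_trans (fC x)); rewrite -mulrA ler_wpM2l//.
  exact: fourth_normal_pdf_le.
by apply: integrable_scale; exact: integrable_normal_pdf.
Qed.

Lemma phi_ge0 x : 0 <= phi x.
Proof. exact: normal_pdf_ge0. Qed.

Lemma measurable_phi : measurable_fun setT phi.
Proof. exact: measurable_normal_pdf. Qed.

Lemma continuous_phi : continuous phi.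
Proof. exact: continuous_normal_pdf. Qed.

Lemma continuous_of_derive (f df : R -> R) :
  (forall x : R, is_derive x (1 : R) f (df x)) -> continuous f.
Proof. by move=> h x; exact/differentiable_continuous/derivable1_diffP. Qed.

Lemma phi_le_harmonic (n : nat) : phi n%:R <= 40 * harmonic n.
Proof.
rewrite /harmonic /= ler_pdivlMr ?ltr0n//.
have h1 : n.+1%:R <= 1 + (n%:R : R) ^+ 4.
  rewrite -natrX -natr1 addrC lerD2l ler_nat.
  by case: n => // n; rewrite -[X in (X <= _)%N]expn1 leq_pexp2l.
apply: (@le_trans _ _ ((1 + n%:R ^+ 4) * phi n%:R)).
  by rewrite mulrC ler_wpM2r ?phi_ge0.
apply: (le_trans (fourth_normal_pdf_le _)).
rewrite ger_pMr//; apply: (le_trans (normal_pdf_ub _ _ _)) => //.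
by apply: (le_trans (normal_peak_le _ _)) => //; rewrite invf_le1// ler1n.
Qed.

Lemma normal_pdf01N x : phi (- x) = phi x.
Proof. by rewrite !normal_pdf01E sqrrN. Qed.

Lemma bounded_phi_cvg0 (g : nat -> R) :
  (forall n, `|g n| <= phi n%:R) -> g @ \oo --> (0 : R).
Proof.
move=> gphi; apply/cvgr0Pnorm_le => /= e e0.
have h : (fun n => 40 * harmonic n : R) @ \oo --> (0 : R).
  by rewrite -[X in _ --> X](mulr0 40); apply: cvgM; [exact: cvg_cst|exact: cvg_harmonic].
near=> n; apply: (le_trans (gphi n)); apply: (le_trans (phi_le_harmonic n)).
near: n; move/cvgr0_norm_le: h => /(_ e e0); apply: filterS => n.
by apply: le_trans; exact: ler_norm.
Unshelve. all: by end_near. Qed.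

Lemma norm_idM_phi_le (x c : R) : `|c| <= 1 -> `|x * c * phi x| <= 1 * ((1 + x ^+ 4) * phi x).
Proof.
move=> c1; rewrite mul1r normrM (ger0_norm (phi_ge0 x)) ler_wpM2r ?phi_ge0//.
rewrite normrM; apply: le_trans (norm_le_1Dfourth x).
by rewrite ler_piMr.
Qed.

Lemma norm_M_phi_le (x c : R) : `|c| <= 1 -> `|c * phi x| <= 1 * ((1 + x ^+ 4) * phi x).
Proof.
move=> c1; rewrite mul1r normrM (ger0_norm (phi_ge0 x)) ler_wpM2r ?phi_ge0//.
by apply: (le_trans c1); rewrite lerDl (exprM x 2 2) sqr_ge0.
Qed.

Lemma norm_cos_le1 (x : R) : `|cos x| <= 1.
Proof. by rewrite ler_norml cos_geN1 cos_le1. Qed.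

Lemma norm_sin_le1 (x : R) : `|sin x| <= 1.
Proof. by rewrite ler_norml sin_geN1 sin_le1. Qed.

Section phase.
Variable s : R.
Implicit Types t x : R.

Lemma measurable_cos_phi t : measurable_fun setT (fun x : R => cos (t * x + s) * phi x).
Proof.
apply: measurable_funM; last exact: measurable_phi.
exact: measurable_cos_affine (@measurable_id _ _ _).
Qed.

Lemma integrable_cos_phi t : mu.-integrable setT (EFin \o (fun x : R => cos (t * x + s) * phi x)).
Proof.
apply: (integrable_le_normal 1) => //; first exact: measurable_cos_phi.
by move=> x; apply: norm_M_phi_le; exact: norm_cos_le1.
Qed.

Lemma continuous_cos_affine t : continuous (fun x : R => cos (t * x + s)).
Proof.
have h := continuous_of_derive _ _ (is_derive_cos_affine t s).
by under eq_fun do rewrite mulrC.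
Qed.

Lemma continuous_sin_affine t : continuous (fun x : R => sin (t * x + s)).
Proof.
have h := continuous_of_derive _ _ (is_derive_sin_affine t s).
by under eq_fun do rewrite mulrC.
Qed.

Lemma integrable_xsin_phi t :
  mu.-integrable setT (EFin \o (fun x : R => x * sin (t * x + s) * phi x)).
Proof.
apply: (integrable_le_normal 1) => //.
  apply: continuous_measurable_fun => x.
  apply: cvgM; last exact: continuous_phi.
  by apply: cvgM; [exact: cvg_id|exact: continuous_sin_affine].
by move=> x; apply: norm_idM_phi_le; exact: norm_sin_le1.
Qed.

(** The difference of the two integrands is the derivative of
    [sin (t * x + s) * phi x], which vanishes at both infinities. *)
Lemma integral_xsin_phi t :
  \int[mu]_x (x * sin (t * x + s) * phi x) = t * \int[mu]_x (cos (t * x + s) * phi x).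
Proof.
apply/eqP; rewrite eq_sym -subr_eq0 -RintegralZl//; last exact: integrable_cos_phi.
have i1 : mu.-integrable setT (EFin \o (fun x : R => t * (cos (t * x + s) * phi x))).
  by apply: integrable_scale; exact: integrable_cos_phi.
rewrite -RintegralB//; last exact: integrable_xsin_phi.
apply/eqP; apply: (Rintegral_derivative (fun x : R => sin (t * x + s) * phi x)).
- move=> x.
  have h1 := is_derive_sin_affine t s x; have h2 := is_derive_normal_pdf x.
  have h := is_deriveM h1 h2.
  rewrite (_ : (fun y => _) = (fun u => sin (u * t + s)) * phi); last first.
    by apply/funext => y; rewrite (mulrC t).
  by apply: (is_derive_eq h); rewrite /GRing.scale/= (mulrC t x); ring.
- move=> x; apply: cvgB.
    apply: cvgM; first exact: cvg_cst.
    by apply: cvgM; [exact: continuous_cos_affine|exact: continuous_phi].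
  apply: cvgM; last exact: continuous_phi.
  by apply: cvgM; [exact: cvg_id|exact: continuous_sin_affine].
- apply: integrable_sub => //; exact: integrable_xsin_phi.
- apply: bounded_phi_cvg0 => n; rewrite normrM (ger0_norm (phi_ge0 _)).
  by rewrite ler_piMl ?phi_ge0// norm_sin_le1.
- apply: bounded_phi_cvg0 => n; rewrite normrM (ger0_norm (phi_ge0 _)) normal_pdf01N.
  by rewrite ler_piMl ?phi_ge0// norm_sin_le1.
Qed.

(** Differentiation under the integral sign, followed by the integration by parts:
    the integral solves the differential equation [c' t = - t * c t]. *)
Lemma is_derive_cos_phi t : is_derive t (1 : R)
  (fun u => \int[mu]_x (cos (u * x + s) * phi x))
  (- t * \int[mu]_x (cos (t * x + s) * phi x)).
Proof.
pose f (u x : R) := cos (u * x + s) * phi x.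
have df u x : is_derive u (1 : R) (f ^~ x) (- (x * sin (u * x + s) * phi x)).
  have h := is_derive_cos_affine x s u.
  rewrite (_ : f ^~ x = phi x \*: (fun u => cos (u * x + s))); last first.
    by apply/funext => y; rewrite /f mulrC.
  by apply: is_derive_eq; rewrite /GRing.scale/= mulrN mulrC.
have tI : `](t - 1), (t + 1)[%classic t by rewrite /= in_itv/= gtrBl ltrDl !ltr01.
pose G x := 1 * ((1 + x ^+ 4) * phi x).
have iG : mu.-integrable setT (EFin \o G).
  apply: (integrable_le_normal 1) => //.
    apply: measurable_funM => //; apply: measurable_funM; last exact: measurable_phi.
    by apply: measurable_funD => //; exact: exprn_measurable.
  move=> x; rewrite ger0_norm // /G mul1r mulr_ge0 ?phi_ge0//.
  by rewrite addr_ge0// (exprM x 2 2) sqr_ge0.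
have fi x : `](t - 1), (t + 1)[%classic x -> mu.-integrable setT (EFin \o f x).
  by move=> _; exact: integrable_cos_phi.
have fd x y : `](t - 1), (t + 1)[%classic x -> setT y -> derivable (f ^~ y) x 1.
  by move=> _ _; exact: ex_derive.
have G0 y : 0 <= G y.
  by rewrite /G mul1r mulr_ge0 ?phi_ge0// addr_ge0// (exprM y 2 2) sqr_ge0.
have fG x y : `](t - 1), (t + 1)[%classic x -> setT y -> `|partial1of2 f x y| <= G y.
  move=> _ _; rewrite partial1of2E derive_val normrN.
  by apply: norm_idM_phi_le; exact: norm_sin_le1.
apply: DeriveDef.
  exact: (derivable_under_integral measurableT tI fi fd G0 iG fG).
rewrite -derive1E (differentiation_under_integral measurableT tI fi fd G0 iG fG).
rewrite mulNr -integral_xsin_phi -mulN1r -RintegralZl//; last exact: integrable_xsin_phi.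
by apply: eq_Rintegral => x _; rewrite partial1of2E derive_val mulN1r.
Qed.

(** The product of the integral with [expR (t ^+ 2 / 2)] has derivative 0. *)
Lemma integral_cos_phi t :
  \int[mu]_x (cos (t * x + s) * phi x) = expR (- (t ^+ 2 / 2)) * cos s.
Proof.
pose c u := \int[mu]_x (cos (u * x + s) * phi x).
pose h := (fun u : R => expR (u ^+ 2 / 2)) * c.
have de u : is_derive u (1 : R) (fun y : R => expR (y ^+ 2 / 2)) (u * expR (u ^+ 2 / 2)).
  pose g : R -> R := 2^-1 \*: (id ^+ 2 : R -> R).
  have gE y : g y = y ^+ 2 / 2 by rewrite /g !fctE /= /GRing.scale/= mulrC.
  have dg : is_derive u (1 : R) g u.
    by apply: is_derive_eq; rewrite expr1 /GRing.scale/= mulr1; field.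
  rewrite (_ : (fun y => _) = expR \o g); last by apply/funext => y /=; rewrite gE.
  have hh : is_derive u (1 : R) (expR \o g) (expR (g u) * u) by exact: is_derive1_comp.
  by apply: (is_derive_eq hh); rewrite gE mulrC.
have dh u : is_derive u (1 : R) h 0.
  have h1 := is_derive_cos_phi u; have h2 := de u.
  have h3 := is_deriveM h2 h1.
  by apply: (is_derive_eq h3); rewrite /GRing.scale/= /c; ring.
have := @is_derive_0_is_cst R h t 0 dh.
rewrite /h /= !fctE expr0n /= mul0r expR0 mul1r.
have -> : c 0 = cos s.
  rewrite /c; under eq_Rintegral do rewrite mul0r add0r.
  rewrite RintegralZl//; last exact: integrable_normal_pdf.
  by rewrite /Rintegral integral_normal_pdf /= mulr1.
move=> e; rewrite -/(c t) -e mulrA -expRD addNr expR0 mul1r //.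
Qed.
End phase.
End normal_characteristic_function.

Section normal_law.
Context {R : realType}.
Notation mu := (@lebesgue_measure R).
Notation nu := (@normal_prob R 0 1).

(** The density is a Radon-Nikodym derivative of the normal law, and these are
    unique up to null sets. *)
Lemma integral_normal_prob (f : R -> \bar R) : nu.-integrable setT f ->
  (\int[nu]_x f x = \int[mu]_x (f x * (normal_pdf 0 1 x)%:E))%E.
Proof.
move=> fi; have mf := measurable_int _ fi.
have mp : measurable_fun setT (fun x : R => (normal_pdf 0 1 x)%:E).
  by apply/measurable_EFinP; exact: measurable_normal_pdf.
have dom := @normal_prob_dominates R 0 1.
rewrite -(Radon_Nikodym_change_of_variables dom)//=.
apply: ae_eq_integral => //.
- apply: emeasurable_funM => //.
- exact (emeasurable_funM mf mp).
- apply: ae_eqe_mul2l => /=.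
  rewrite Radon_NikodymE/=.
  case: cid => /= h [h1 h2 h3].
  apply: integral_ae_eq => //=.
  + by move=> E _ mE; rewrite -h3.
Qed.

Lemma gauss_close_normal (delta : R) : 0 <= delta -> gauss_close nu id delta.
Proof.
move=> d0 t s.
have i1 : nu.-integrable setT (EFin \o (fun x : R => cos (t * x + s))).
  by apply: (integrable_cos_affine nu id t s); exact: measurable_id.
rewrite /Rintegral (integral_normal_prob (EFin \o (fun x : R => cos (t * x + s)))) //.
have := integral_cos_phi s t; rewrite /Rintegral /=.
under eq_integral do rewrite EFinM.
by move=> ->; rewrite subrr normr0 mulr_ge0 ?exprn_ge0.
Qed.
End normal_law.

(** * Smoothing a law by a normal law *)
Section smoothing.
Context {R : realType}.
Notation lam := (@lebesgue_measure R).
Notation phi := (@normal_pdf R 0 1).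

(** Up to the factor [normal_peak e], the density at [x] of the convolution of [m]
    with N(0,e^2). *)
Definition gauss_average (m : probability R R) (e x : R) : R :=
  \int[m]_w expR (- (((x - w) / e) ^+ 2 / 2)).

Definition abs_moment3 : R := \int[lam]_u (`|u| ^+ 3 * phi u).

Lemma integrable_abs3_phi : lam.-integrable setT (EFin \o (fun u : R => `|u| ^+ 3 * phi u)).
Proof.
apply: (integrable_le_normal 1) => //.
  apply: measurable_funM; last exact: measurable_phi.
  by apply: measurable_funX; exact: normr_measurable.
move=> u; rewrite mul1r ger0_norm ?mulr_ge0 ?exprn_ge0 ?phi_ge0//.
by rewrite ler_wpM2r ?phi_ge0// cube_le_1Dfourth.
Qed.

Lemma abs_moment3_ge0 : 0 <= abs_moment3.
Proof. by apply: Rintegral_ge0 => u _; rewrite mulr_ge0 ?exprn_ge0 ?phi_ge0. Qed.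

(** The Gaussian kernel is written as a Fourier integral by [integral_cos_phi], and
    the two integrations are exchanged. *)
Lemma gauss_averageE (m : probability R R) (e x : R) :
  lam.-integrable setT (EFin \o (fun u : R =>
     (\int[m]_w cos ((- (u / e)) * w + x * u / e)) * phi u)) /\
  gauss_average m e x =
  \int[lam]_u ((\int[m]_w cos ((- (u / e)) * w + x * u / e)) * phi u).
Proof.
pose F (z : R * R) := cos (((x - z.2) / e) * z.1 + 0) * phi z.1.
have mF : measurable_fun setT F.
  apply: measurable_funM; last first.
    by apply: (measurableT_comp (@measurable_phi R)); exact: measurable_fst.
  apply: measurableT_comp; first by apply: continuous_measurable_fun; exact: continuous_cos.
  apply: measurable_funD => //; apply: measurable_funM; last exact: measurable_fst.
  by apply: measurable_funM => //; apply: measurable_funB.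
have iF : (lam \x m)%E.-integrable setT (EFin \o F).
  apply/(integrable12ltyP _) => /=; first exact/measurable_EFinP.
  apply: (@le_lt_trans _ _ (\int[lam]_u (phi u)%:E)%E); last by rewrite integral_normal_pdf ltry.
  apply: ge0_le_integral => //.
  - by move=> u _; exact: integral_ge0.
  - apply: (measurable_fun_fubini_tonelli_F (m2 := m) (fun z => `|(F z)%:E|%E)) => //.
    by apply: measurableT_comp => //; exact/measurable_EFinP.
  - by apply/measurable_EFinP; exact: measurable_phi.
  - move=> u _.
    apply: (@le_trans _ _ (\int[m]_w (phi u)%:E)%E); last first.
      rewrite integral_cst// -[leRHS]mule1 lee_wpmul2l ?lee_fin ?phi_ge0//.
      exact: probability_le1.
    have mFu : measurable_fun setT (fun w : R => F (u, w)).
      exact: (measurableT_comp mF (pair1_measurable u)).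
    have mFe : measurable_fun setT (fun w : R => (`|F (u, w)|)%:E).
      by apply/measurable_EFinP; exact: (measurableT_comp (@normr_measurable R setT) mFu).
    apply: ge0_le_integral => //.
    move=> w _; rewrite lee_fin normrM (ger0_norm (phi_ge0 _)) ler_piMl ?phi_ge0//.
    exact: norm_cos_le1.
have FE u : (\int[m]_w (F (u, w))%:E)%E =
    ((\int[m]_w cos (- (u / e) * w + x * u / e)) * phi u)%:E.
  have mc : m.-integrable setT (EFin \o (fun w : R => cos (- (u / e) * w + x * u / e))).
    by apply: (integrable_cos_affine m id); exact: measurable_id.
  rewrite EFinM fineK ?integrable_fin_num// -integralZr//.
  apply: eq_integral => w _; rewrite -EFinM /F /=; congr (cos _ * _)%:E.
  by rewrite addr0; ring.
have h := integrable_fubini_F iF.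
split.
  rewrite (_ : EFin \o _ = fubini_F m (EFin \o F))//.
  by apply/funext => u /=; rewrite -FE.
rewrite /gauss_average.
have -> : \int[m]_w expR (- (((x - w) / e) ^+ 2 / 2)) =
  fine (\int[m]_w \int[lam]_u (F (u, w))%:E)%E.
  rewrite /Rintegral; congr fine; apply: eq_integral => w _.
  have := integral_cos_phi 0 ((x - w) / e); rewrite cos0 mulr1 => <-.
  by rewrite fineK// integrable_fin_num//; exact: integrable_cos_phi.
rewrite -(Fubini iF) /Rintegral; congr fine; apply: eq_integral => u _.
exact: FE.
Qed.

(** The comparison term does not depend on [m]: two laws that are both close to
    normal have close averages. *)
Lemma gauss_average_close (m : probability R R) (delta e x : R) : 0 < e ->
  gauss_close m id delta ->
  `| gauss_average m e x -
     \int[lam]_u ((expR (- ((u / e) ^+ 2 / 2)) * cos (x * u / e)) * phi u) |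
  <= delta * abs_moment3 / e ^+ 3.
Proof.
move=> e0 md.
have [i1 ->] := gauss_averageE m e x.
have i2 : lam.-integrable setT (EFin \o
  (fun u : R => expR (- ((u / e) ^+ 2 / 2)) * cos (x * u / e) * phi u)).
  apply: (integrable_le_normal 1) => //.
    apply: measurable_funM; last exact: measurable_phi.
    apply: measurable_funM.
      apply: measurableT_comp => //; apply: measurableT_comp => //.
      by apply: measurable_funM => //; apply: measurable_funX; exact: measurable_funM.
    under eq_fun do rewrite mulrAC -[X in cos X]addr0.
    by apply: (measurable_cos_affine id); exact: measurable_id.
  move=> u; apply: norm_M_phi_le; rewrite normrM (ger0_norm (expR_ge0 _)).
  rewrite mulr_ile1 ?expR_ge0 ?normr_ge0 ?norm_cos_le1//.
  by rewrite -expR0 ler_expR oppr_le0 mulr_ge0 ?sqr_ge0 ?invr_ge0.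
rewrite -RintegralB//; apply: (le_trans (le_normr_Rintegral _ _)) => //.
  exact: integrable_sub.
apply: (@le_trans _ _ (\int[lam]_u (delta / e ^+ 3 * (`|u| ^+ 3 * phi u)))); last first.
  rewrite RintegralZl//; last exact: integrable_abs3_phi.
  by rewrite -/abs_moment3 mulrAC.
apply: le_Rintegral => //.
- by apply: integrable_norm; exact: integrable_sub.
- by apply: integrable_scale; exact: integrable_abs3_phi.
move=> u _; rewrite -mulrBl normrM (ger0_norm (phi_ge0 u)) mulrA.
rewrite ler_wpM2r ?phi_ge0//.
have := md (- (u / e)) (x * u / e); rewrite sqrrN normrN => H; apply: (le_trans H).
rewrite normf_div (gtr0_norm e0) le_eqVlt; apply/orP; left; apply/eqP.
by field; rewrite gt_eqF.
Qed.
End smoothing.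

Section smoothing_inequality.
Context {R : realType}.
Notation lam := (@lebesgue_measure R).

Lemma normal_pdf_kernelE (w e x : R) : 0 < e ->
  normal_pdf w e x = normal_peak e * expR (- (((x - w) / e) ^+ 2 / 2)).
Proof.
move=> e0; rewrite normal_pdfE ?gt_eqF// /normal_fun; congr (_ * expR _).
by field; rewrite gt_eqF.
Qed.

Lemma measurable_kernel (e : R) :
  measurable_fun setT (fun z : R * R => expR (- (((z.2 - z.1) / e) ^+ 2 / 2))).
Proof.
apply: measurableT_comp => //; apply: measurableT_comp => //.
apply: measurable_funM => //; apply: measurable_funX; apply: measurable_funM => //.
by apply: measurable_funB; [exact: measurable_snd|exact: measurable_fst].
Qed.

Lemma kernel_le1 (y : R) : expR (- (y ^+ 2 / 2)) <= 1.
Proof. by rewrite -expR0 ler_expR oppr_le0 mulr_ge0 ?sqr_ge0 ?invr_ge0. Qed.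

Lemma integrable_kernel (m : probability R R) (e x : R) :
  m.-integrable setT (EFin \o (fun w : R => expR (- (((x - w) / e) ^+ 2 / 2)))).
Proof.
apply: (integrable_bounded m 1).
  exact: (measurableT_comp (measurable_kernel e) (pair2_measurable x)).
by move=> w; rewrite ger0_norm ?expR_ge0 ?kernel_le1.
Qed.

Section interval.
Variables a b e : R.
Hypothesis e0 : 0 < e.

Let f (z : R * R) : \bar R :=
  (normal_peak e * (expR (- (((z.2 - z.1) / e) ^+ 2 / 2)) * \1_(`[a, b]%classic : set R) z.2))%:E.

Let f0 z : (0 <= f z)%E.
Proof. by rewrite lee_fin mulr_ge0 ?normal_peak_ge0// mulr_ge0 ?expR_ge0. Qed.

Let mf : measurable_fun setT f.
Proof.
apply/measurable_EFinP; apply: measurable_funM => //; apply: measurable_funM.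
  exact: measurable_kernel.
by apply: (measurableT_comp (measurable_indic _) measurable_snd).
Qed.

Let normal_itvE w : normal_prob w e `[a, b] = (\int[lam]_x f (w, x))%E.
Proof.
rewrite /normal_prob integral_mkcond; apply: eq_integral => x _.
rewrite patchE /f /= indicE; case: ifPn => xab.
  by rewrite mulr1 normal_pdf_kernelE.
by rewrite mulr0 mulr0.
Qed.

Lemma measurable_normal_itv : measurable_fun setT (fun w : R => normal_prob w e `[a, b]).
Proof.
under eq_fun do rewrite normal_itvE.
by apply: (measurable_fun_fubini_tonelli_F (m2 := lam) f).
Qed.

(** Both sides are the mass that the convolution of [m] with N(0,e^2) gives to
    the interval from [a] to [b]. *)
Lemma integral_normal_itv (m : probability R R) :
  (\int[m]_w normal_prob w e `[a, b] =
   \int[lam]_(x in `[a, b]) (normal_peak e * gauss_average m e x)%:E)%E.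
Proof.
under eq_integral do rewrite normal_itvE.
have -> : (\int[m]_w \int[lam]_x f (w, x) = \int[lam]_x \int[m]_w f (w, x))%E.
  exact: (fubini_tonelli (m1 := m) (m2 := lam) f).
rewrite [RHS]integral_mkcond; apply: eq_integral => x _.
have ik := integrable_kernel m e x.
rewrite patchE; case: ifPn => xab.
  rewrite EFinM /gauss_average /Rintegral fineK ?integrable_fin_num//.
  rewrite -integralZl//; apply: eq_integral => w _.
  by rewrite /f /= indicE xab mulr1 EFinM.
under eq_integral do rewrite /f /= indicE (negbTE xab) mulr0 mulr0.
by rewrite integral0.
Qed.

Lemma measurable_gauss_average (m : probability R R) : measurable_fun setT (gauss_average m e).
Proof.
pose g (z : R * R) := (expR (- (((z.2 - z.1) / e) ^+ 2 / 2)))%:E.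
apply/measurable_EFinP.
rewrite (_ : EFin \o _ = fun x => (\int[m]_w g (w, x))%E); last first.
  apply/funext => x; rewrite /= /gauss_average /Rintegral fineK// integrable_fin_num//.
  exact: integrable_kernel.
apply: (measurable_fun_fubini_tonelli_G (m1 := m) g) => //.
  by apply/measurable_EFinP; exact: measurable_kernel.
by move=> z; rewrite lee_fin expR_ge0.
Qed.

Lemma gauss_average_ge0 (m : probability R R) x : 0 <= gauss_average m e x.
Proof. by apply: Rintegral_ge0 => w _; exact: expR_ge0. Qed.

Lemma integral_normal_itv_le (m1 m2 : probability R R) (kappa : R) :
  a <= b -> 0 <= kappa ->
  (forall x, gauss_average m1 e x <= gauss_average m2 e x + kappa) ->
  (\int[m1]_w normal_prob w e `[a, b] <=
   \int[m2]_w normal_prob w e `[a, b] + ((b - a) * (kappa / e))%:E)%E.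
Proof.
move=> ab k0 m12; rewrite !integral_normal_itv.
have mA m : measurable_fun (`[a, b]%classic : set R)
    (fun x => (normal_peak e * gauss_average m e x)%:E).
  apply/measurable_EFinP/measurable_funTS; apply: measurable_funM => //.
  exact: measurable_gauss_average.
apply: (@le_trans _ _ (\int[lam]_(x in `[a, b])
   ((normal_peak e * gauss_average m2 e x)%:E + (normal_peak e * kappa)%:E))%E).
  apply: ge0_le_integral => //.
  - by move=> x _; rewrite lee_fin mulr_ge0 ?normal_peak_ge0 ?gauss_average_ge0.
  - exact: mA.
  - by apply: emeasurable_funD => //; exact: mA.
  - by move=> x _; rewrite -EFinD lee_fin -mulrDr ler_wpM2l ?normal_peak_ge0.
rewrite ge0_integralD//; last 3 first.
- by move=> x _; rewrite lee_fin mulr_ge0 ?normal_peak_ge0 ?gauss_average_ge0.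
- exact: mA.
- by move=> x _; rewrite lee_fin mulr_ge0 ?normal_peak_ge0.
rewrite leeD2l// integral_cst//= lebesgue_measure_itv/= lte_fin.
case: ltP => _.
  rewrite -EFinD -EFinM lee_fin mulrC ler_wpM2l ?subr_ge0// mulrC ler_wpM2l//.
  exact: normal_peak_le.
by rewrite mule0 lee_fin mulr_ge0 ?subr_ge0// divr_ge0// ltW.
Qed.

Variable h : R.
Hypothesis h0 : 0 < h.
Let tau := 16 / 3 * (e / h) ^+ 2.

(** [normal_prob w e `[a, b]], as a function of [w], is the indicator of the
    interval smoothed at scale [e]: at distance [h] or more from the end points it
    is [tau]-close to 1 inside and to 0 outside. *)
Lemma normal_itv_ge w : a + h <= w <= b - h -> (1 <= normal_prob w e `[a, b] + tau%:E)%E.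
Proof.
move=> /andP[aw wb]; have := normal_tail_le w e h e0 h0.
set D := [set x | _] => Dtau.
have mD : measurable D by exact: measurable_dist_gt.
have e1 : (normal_prob w e (`[a, b]%classic `|` D) = 1)%E.
  rewrite (_ : _ `|` D = setT); first exact: (probability_setT (normal_prob w e)).
  apply/seteqP; split => // x _.
  have [xw|xw] := leP (`|x - w|) h; last by right.
  left; rewrite /= in_itv/=; move: xw; rewrite ler_norml => /andP[x1 x2].
  by apply/andP; split; lra.
rewrite -e1; apply: (le_trans (measureU2 (normal_prob w e) _ _)) => //.
by rewrite leeD2l.
Qed.

Lemma normal_itv_le w : b + h < w -> (normal_prob w e `[a, b] <= tau%:E)%E.
Proof.
move=> bw; apply: le_trans (normal_tail_le w e h e0 h0).
apply: le_measure; rewrite ?inE//; first exact: measurable_dist_gt.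
move=> x /=; rewrite in_itv/= => /andP[_ xb].
have xw : x + h < w by rewrite (le_lt_trans _ bw)// lerD2r.
rewrite distrC ger0_norm ?subr_ge0; first by rewrite ltrBrDl.
by rewrite ltW// (lt_trans _ xw)// ltrDl.
Qed.
End interval.

Lemma integral_prob_cst_le (m : probability R R) (c : R) : 0 <= c ->
  (\int[m]_w c%:E <= c%:E)%E.
Proof.
move=> c0; rewrite integral_cst// -[leRHS]mule1 lee_wpmul2l// ?lee_fin//.
exact: probability_le1.
Qed.

(** The smoothed indicator of the interval from [- t - h] to [x + h] is at least
    [1 - tau] between [- t] and [x] and at most [tau] beyond [x + 2 * h].  Each passage
    between indicator and smoothed indicator costs [tau]. *)
Lemma cdf_le_smoothing (m1 m2 : probability R R) (e h kappa t x : R) :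
  0 < e -> 0 < h -> 0 <= kappa -> - t <= x ->
  (forall y, gauss_average m1 e y <= gauss_average m2 e y + kappa) ->
  (m1 `]-oo, x]%classic <= m1 `]-oo, (- t)%R[%classic + m2 `]-oo, (x + 2 * h)%R]%classic +
    ((x + t + 2 * h) * (kappa / e) + 2 * (16 / 3 * (e / h) ^+ 2))%R%:E)%E.
Proof.
move=> e0 h0 k0 tx m12.
pose a := - t - h; pose b := x + h; pose tau := 16 / 3 * (e / h) ^+ 2.
have tau0 : 0 <= tau by rewrite mulr_ge0// sqr_ge0.
have ab : a <= b by rewrite /a /b; lra.
pose H w := normal_prob w e `[a, b].
have mH : measurable_fun setT H by exact: measurable_normal_itv.
have H0 w : (0 <= H w)%E by exact: measure_ge0.
have S1 : (m1 `[(- t)%R, x]%classic <= \int[m1]_w H w + tau%:E)%E.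
  have -> : m1 `[(- t), x]%classic = (\int[m1]_w (\1_(`[(- t)%R, x]%classic : set R) w)%:E)%E.
    by rewrite integral_indic// setIT.
  apply: (@le_trans _ _ (\int[m1]_w (H w + tau%:E))%E).
    apply: ge0_le_integral => //.
    - exact/measurable_EFinP/measurable_indic.
    - exact: emeasurable_funD.
    - move=> w _; rewrite indicE; have [wE|wE] := boolP (w \in _).
        apply: normal_itv_ge => //; move: wE; rewrite inE/= in_itv/= /a /b.
        by move=> /andP[? ?]; apply/andP; split; lra.
      by rewrite adde_ge0.
  rewrite ge0_integralD//.
  by apply: leeD2l; exact: integral_prob_cst_le.
have S2 : (\int[m2]_w H w <= m2 `]-oo, (x + 2 * h)%R]%classic + tau%:E)%E.
  have -> : m2 `]-oo, (x + 2 * h)]%classic =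
     (\int[m2]_w (\1_(`]-oo, (x + 2 * h)%R]%classic : set R) w)%:E)%E.
    by rewrite integral_indic// setIT.
  apply: (@le_trans _ _ (\int[m2]_w ((\1_(`]-oo, (x + 2 * h)%R]%classic : set R) w)%:E + tau%:E))%E).
    apply: ge0_le_integral => //.
    - by apply: emeasurable_funD => //; exact/measurable_EFinP/measurable_indic.
    - move=> w _; rewrite indicE; have [wE|wE] := boolP (w \in _).
        rewrite (le_trans (probability_le1 (normal_prob w e) _))//.
        by rewrite -EFinD lee_fin lerDl.
      rewrite add0e; apply: normal_itv_le => //.
      move: wE; rewrite notin_setE/= in_itv/= => /negP; rewrite -ltNge /b; lra.
  rewrite ge0_integralD//; last exact/measurable_EFinP/measurable_indic.
  by apply: leeD2l; exact: integral_prob_cst_le.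
have S3 : (\int[m1]_w H w <= \int[m2]_w H w + ((b - a) * (kappa / e))%:E)%E.
  exact: integral_normal_itv_le.
apply: (@le_trans _ _ (m1 `]-oo, (- t)%R[%classic + m1 `[(- t)%R, x]%classic)%E).
  rewrite (_ : `]-oo, x]%classic = `]-oo, (- t)[%classic `|` `[(- t), x]%classic).
    exact: measureU2.
  apply/seteqP; split => y /=; rewrite !in_itv/=.
    by move=> yx; have [yt|yt] := ltP y (- t); [left|right; rewrite yx].
  by move=> [yt|/andP[]//]; apply: le_trans tx; exact: ltW.
rewrite -addeA leeD2l//; apply: (le_trans S1).
apply: (@le_trans _ _ (m2 `]-oo, (x + 2 * h)%R]%classic + tau%:E + ((b - a) * (kappa / e))%:E + tau%:E)%E).
  by rewrite leeD2r// (le_trans S3)// leeD2r.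
rewrite -!addeA leeD2l// -!EFinD lee_fin /a /b -/tau; lra.
Qed.
End smoothing_inequality.

(** * From characteristic functions to the L1 distance *)
Section wasserstein.
Context {R : realType}.
Notation lam := (@lebesgue_measure R).
Definition tails_le (m : probability R R) (K : R) : Prop :=
  forall r : R, 0 < r -> (m [set w : R | (r <= `|w|)%R] <= (K / r ^+ 2)%R%:E)%E.

Lemma measurable_tail (r : R) : measurable [set w : R | r <= `|w|].
Proof.
rewrite (_ : [set w : R | _] = (fun x => `|x|) @^-1` `[r, +oo[); last first.
  by apply/seteqP; split => x /=; rewrite in_itv/= andbT.
rewrite -[X in measurable X]setTI.
exact: (@normr_measurable R setT).
Qed.

Variable nu : probability R R.
Hypothesis nu_normal : forall A : set R, measurable A -> nu A = normal_prob 0 1 A.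

(* The normal law lives on the sigma-algebra generated by half-open intervals,
   [nu] on the canonical one of the real line; the identity transports integrals. *)
Let measurable_idR :
  measurable_fun setT (id : g_sigma_algebraType R.-ocitv.-measurable -> R).
Proof. exact: measurable_id. Qed.

Let idR : {mfun g_sigma_algebraType R.-ocitv.-measurable >-> R} :=
  HB.pack (id : g_sigma_algebraType R.-ocitv.-measurable -> R)
    (isMeasurableFun.Build _ _ _ _ _ measurable_idR).

Lemma gauss_close_normal_law (delta : R) : 0 <= delta -> gauss_close nu id delta.
Proof.
move=> d0 t s; have := gauss_close_normal delta d0 t s; rewrite /Rintegral /=.
pose N := distribution (normal_prob (0 : R) 1) idR.
have mc : measurable_fun setT (fun w : R => (cos (t * w + s))%:E).
  by apply/measurable_EFinP; apply: (measurable_cos_affine id); exact: measurable_id.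
have -> // : (\int[nu]_w (cos (t * w + s))%:E =
             \int[normal_prob 0 1]_w (cos (t * w + s))%:E)%E.
rewrite (@eq_measure_integral _ _ _ _ N); last by move=> A mA _; exact: nu_normal.
rewrite integral_distribution//.
by apply: (integrable_cos_affine (normal_prob 0 1) id); exact: measurable_id.
Qed.

Lemma normal_increment_le (x h : R) : 0 <= h ->
  (nu `]-oo, (x + h)%R]%classic <= nu `]-oo, x]%classic + h%:E)%E.
Proof.
move=> h0.
rewrite (_ : `]-oo, (x + h)]%classic = `]-oo, x]%classic `|` `]x, (x + h)]%classic); last first.
  apply/seteqP; split => y /=; rewrite !in_itv/=.
    by move=> yx; have [yt|yt] := leP y x; [left|right; rewrite yx].
  by move=> [yt|/andP[]//]; apply: (le_trans yt); rewrite lerDl.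
suff H : (nu `]x, (x + h)%R]%classic <= h%:E)%E.
  by apply: (le_trans (measureU2 nu _ _)) => //; exact: leeD2l.
rewrite nu_normal//.
apply: (@le_trans _ _ (\int[lam]_(y in `]x, (x + h)%R]) (1 : \bar R))%E).
  apply: ge0_le_integral => //.
  - by move=> y _; rewrite lee_fin phi_ge0.
  - by apply/measurable_EFinP/measurable_funTS; exact: measurable_phi.
  - move=> y _; rewrite lee_fin (le_trans (normal_pdf_ub _ _ _))//.
    by rewrite (le_trans (normal_peak_le _ _))// invr1.
rewrite integral_cst//= mul1e lebesgue_measure_itv/= lte_fin.
case: ltP => _; last by rewrite lee_fin.
by rewrite -EFinD lee_fin addrAC subrr add0r.
Qed.

Lemma normal_tails_le : tails_le nu 22.
Proof.
move=> r r0.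
have r20 : 0 < r / 2 by rewrite divr_gt0.
have := normal_tail_le 0 1 (r / 2) ltr01 r20.
rewrite nu_normal; last exact: measurable_tail.
set D := [set x | _] => h; apply: (@le_trans _ _ (normal_prob 0 1 D)).
  apply: le_measure; rewrite ?inE.
  - exact: measurable_tail.
  - exact: measurable_dist_gt.
  - move=> x /= rx; rewrite /D /= subr0; apply: lt_le_trans rx.
    by rewrite ltr_pdivrMr// ltr_pMr// ltr1n.
apply: (le_trans h); rewrite lee_fin.
rewrite (_ : 16 / 3 * (1 / (r / 2)) ^+ 2 = 64 / 3 / r ^+ 2); last by field; rewrite gt_eqF.
by rewrite ler_wpM2r ?invr_ge0 ?exprn_ge0 ?(ltW r0)//; lra.
Qed.

Lemma integral_inv_sqr (t c : R) : 0 < t -> 0 <= c ->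
  (\int[lam]_(x in `[t, +oo[) (c / x ^+ 2)%:E = (c / t)%:E)%E.
Proof.
move=> t0 c0.
have dF (x : R) : 0 < x -> is_derive x (1 : R) (fun y : R => - c / y) (c / x ^+ 2).
  move=> x0.
  have h := @is_deriveV R id x 1 1 (lt0r_neq0 x0) (is_derive_id _ _).
  rewrite (_ : (fun y => _) = (- c) \*: (fun y : R => (id y)^-1)); last by apply/funext.
  by apply: is_derive_eq; rewrite /GRing.scale/= mulr1 mulrNN.
have cont (x : R) : 0 < x -> {for x, continuous (fun y : R => c / y ^+ 2)}.
  move=> x0; apply: cvgM; first exact: cvg_cst.
  by apply: cvgV; [rewrite expf_neq0// gt_eqF|exact: exprn_continuous].
rewrite (@ge0_continuous_FTC2y _ _ (fun y => - c / y) t 0).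
- by rewrite -EFinB sub0r mulNr opprK.
- by move=> x tx; rewrite divr_ge0// sqr_ge0.
- apply/continuous_within_itvcyP; split.
    by move=> x; rewrite in_itv/= andbT => tx; apply: cont; exact: lt_trans tx.
  by apply: cvg_at_right_filter; exact: cont.
- rewrite -[X in _ --> X](mulr0 (- c)); apply: cvgM; first exact: cvg_cst.
  by apply/gtr0_cvgV0; [exact: nbhs_pinfty_gt|exact: cvg_id].
- by move=> x tx; have := dF x (lt_trans t0 tx) => h; exact: ex_derive.
- have h := dF t t0; apply: cvg_at_right_filter.
  have cF : {for t, continuous (fun y : R => - c / y)}.
    exact/differentiable_continuous/derivable1_diffP.
  exact: cF.
- move=> x; rewrite in_itv/= andbT => tx; rewrite derive1E.
  by have := dF x (lt_trans t0 tx) => h; rewrite derive_val.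
Qed.

Lemma integral_inv_sqr_neg (t c : R) : 0 < t -> 0 <= c ->
  (\int[lam]_(x in `]-oo, (- t)%R]) (c / x ^+ 2)%:E = (c / t)%:E)%E.
Proof.
move=> t0 c0; rewrite -(integral_inv_sqr t c t0 c0).
rewrite (@ge0_integration_by_substitutionNy R (fun x : R => c / x ^+ 2) t).
- by apply: eq_integral => x _; rewrite /= sqrrN.
- apply/continuous_within_itvNycP; split.
    move=> x; rewrite in_itv/= => xt.
    apply: cvgM; first exact: cvg_cst.
    apply: cvgV; last exact: exprn_continuous.
    by rewrite expf_neq0// lt_eqF// (lt_trans xt)// oppr_lt0.
  apply: cvg_at_left_filter.
  apply: cvgM; first exact: cvg_cst.
  apply: cvgV; last exact: exprn_continuous.
  by rewrite expf_neq0// lt_eqF// oppr_lt0.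
- by move=> x _; rewrite divr_ge0// sqr_ge0.
Qed.

(** The smoothing inequality is applied in both directions, with scale [u ^+ 3],
    shift [u ^+ 2] and cut-off slightly above [1 / u]. *)
Lemma cdf_dist_le (mu1 : probability R R) (A u x : R) : 0 < u <= 1 -> 0 <= A ->
  tails_le mu1 22 -> gauss_close mu1 id (A * u ^+ 15) ->
  `|x| <= u^-1 ->
  `|fine (mu1 `]-oo, x]%classic) - fine (nu `]-oo, x]%classic)| <=
    (35 + 12 * A * (@abs_moment3 R)) * u ^+ 2.
Proof.
move=> /andP[u0 u1] A0 tail1 close1 xu.
set M := @abs_moment3 R; have M0 : 0 <= M by exact: abs_moment3_ge0.
(* The extra [2 * h] in [t] keeps [x - 2 * h] above [- t]. *)
pose e := u ^+ 3; pose h := u ^+ 2; pose t := u^-1 + 2 * h.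
pose kappa := 2 * (A * u ^+ 15 * M / e ^+ 3).
have e0 : 0 < e by rewrite exprn_gt0.
have h0 : 0 < h by rewrite exprn_gt0.
have ui0 : 0 < u^-1 by rewrite invr_gt0.
have d0 : 0 <= A * u ^+ 15 by rewrite mulr_ge0// exprn_ge0// ltW.
have k0 : 0 <= kappa.
  by rewrite /kappa !mulr_ge0 ?invr_ge0 ?exprn_ge0 ?(ltW e0) ?(ltW u0).
have close2 := gauss_close_normal_law _ d0.
have comp y : `|gauss_average mu1 e y - gauss_average nu e y| <= kappa.
  have := gauss_average_close mu1 _ e y e0 close1.
  have := gauss_average_close nu _ e y e0 close2.
  rewrite -/M; set K := \int[lam]_u0 _; rewrite !ler_norml /kappa => /andP[? ?] /andP[? ?].
  by apply/andP; split; lra.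
pose S := 22 * u ^+ 2 + (6 / u * (kappa / e) + 2 * (16 / 3 * (e / h) ^+ 2)).
have eh : e / h = u by rewrite /e /h; field; rewrite gt_eqF.
have ke : kappa / e = 2 * A * M * u ^+ 3.
  by rewrite /kappa /e; field; rewrite gt_eqF.
have main (m1 m2 : probability R R) y : tails_le m1 22 -> - t <= y -> y <= u^-1 ->
   (forall z, gauss_average m1 e z <= gauss_average m2 e z + kappa) ->
   fine (m1 `]-oo, y]%classic) <= fine (m2 `]-oo, (y + 2 * h)%R]%classic) + S.
  move=> tl ty yu comp12.
  have := cdf_le_smoothing m1 m2 e h kappa t y e0 h0 k0 ty comp12.
  have t0 : 0 < t by rewrite addr_gt0// mulr_gt0.
  have T1 : (m1 `]-oo, (- t)%R[%classic <= (22 * u ^+ 2)%:E)%E.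
    apply: (@le_trans _ _ (m1 [set w : R | (t <= `|w|)%R])).
      apply: le_measure; rewrite ?inE//; first exact: measurable_tail.
      move=> w /=; rewrite in_itv/= => wt; rewrite ltr0_norm; last by rewrite (lt_trans wt)// oppr_lt0.
      by rewrite lerNr ltW.
    apply: (le_trans (tl t t0)); rewrite lee_fin ler_wpM2l//.
    rewrite -exprVn ler_sqr ?nnegrE ?invr_ge0 ?(ltW t0)// ?(ltW u0)//.
    by rewrite invf_ple ?posrE// lerDl mulr_ge0// ltW.
  move=> H; rewrite -lee_fin EFinD !fineK ?fin_num_measure//.
  apply: (le_trans H); rewrite (addeC (m1 _)) -addeA; apply: leeD2l.
  rewrite /S [leRHS]EFinD; apply: leeD => //; rewrite lee_fin eh lerD2r.
  rewrite ler_wpM2r ?divr_ge0 ?(ltW e0)//.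
  have : u ^+ 2 <= 1 by rewrite exprn_ile1// ltW.
  have : 1 <= u^-1 by rewrite invf_ge1.
  rewrite /t /h; lra.
have incr y : fine (nu `]-oo, (y + 2 * h)%R]%classic) <= fine (nu `]-oo, y]%classic) + 2 * h.
  rewrite -lee_fin EFinD !fineK ?fin_num_measure//.
  by apply: normal_increment_le; rewrite mulr_ge0// ltW.
have S2 : S + 2 * h <= (35 + 12 * A * M) * u ^+ 2.
  rewrite /S eh ke /h (_ : 6 / u * (2 * A * M * u ^+ 3) = 12 * A * M * u ^+ 2).
    by have := sqr_ge0 u; nra.
  by field; rewrite gt_eqF.
move: xu; rewrite ler_norml => /andP[x1 x2].
have d1 : fine (mu1 `]-oo, x]%classic) <= fine (nu `]-oo, (x + 2 * h)%R]%classic) + S.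
  apply: main => // [|z]; first by rewrite (le_trans _ x1)// lerN2 lerDl mulr_ge0// ltW.
  by have := comp z; rewrite ler_norml => /andP[_]; rewrite lerBlDl.
have d2 : fine (nu `]-oo, (x - 2 * h)%R]%classic) <=
          fine (mu1 `]-oo, (x - 2 * h + 2 * h)%R]%classic) + S.
  apply: main => // [|||z].
  - exact: normal_tails_le.
  - by rewrite /t opprD lerD2r.
  - by rewrite (le_trans _ x2)// lerBlDr lerDl mulr_ge0// ltW.
  - by have := comp z; rewrite distrC ler_norml => /andP[_]; rewrite lerBlDl.
have i1 := incr x; have i2 := incr (x - 2 * h).
rewrite subrK in d2 i2.
rewrite ler_norml; apply/andP; split; lra.
Qed.

Lemma cdf_tail_dist_le (mu1 : probability R R) (x : R) : x != 0 ->
  tails_le mu1 22 ->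
  `|fine (mu1 `]-oo, x]%classic) - fine (nu `]-oo, x]%classic)| <= 22 / x ^+ 2.
Proof.
move=> x0 tail1.
have half (m : probability R R) : tails_le m 22 ->
    if x < 0 then 0 <= fine (m `]-oo, x]%classic) <= 22 / x ^+ 2
    else 1 - 22 / x ^+ 2 <= fine (m `]-oo, x]%classic) <= 1.
  move=> tl.
  have nx : 0 < `|x| by rewrite normr_gt0.
  have := tl `|x| nx; rewrite real_normK ?num_real// => tlx.
  case: ltP => [xlt|xge].
    rewrite fine_ge0//= -lee_fin fineK ?fin_num_measure//.
    apply: le_trans tlx; apply: le_measure; rewrite ?inE//; first exact: measurable_tail.
    move=> w /=; rewrite in_itv/= => wx; rewrite ltr0_norm// ler0_norm ?lerN2//.
    exact: le_trans wx (ltW xlt).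
  have m1 : (m `]-oo, x]%classic <= 1)%E by exact: probability_le1.
  apply/andP; split; last by rewrite -lee_fin fineK ?fin_num_measure.
  rewrite lerBlDr -lee_fin EFinD fineK ?fin_num_measure//.
  have e1 : (m (`]-oo, x]%classic `|` [set w : R | (`|x| <= `|w|)%R]) = 1)%E.
    rewrite (_ : _ `|` _ = setT); first exact: probability_setT.
    apply/seteqP; split => // w _; have [wx|wx] := leP w x; first by left; rewrite /= in_itv.
    by right; rewrite /= !ger0_norm// ?ltW// (le_lt_trans xge).
  rewrite -e1; apply: (le_trans (measureU2 m _ _)) => //; first exact: measurable_tail.
  exact: leeD2l.
have h1 := half mu1 tail1; have h2 := half nu normal_tails_le.
have c0 : 0 <= 22 / x ^+ 2 by rewrite divr_ge0// sqr_ge0.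
rewrite ler_norml.
by move: h1 h2; case: ifP => _ /andP[? ?] /andP[? ?]; apply/andP; split; lra.
Qed.
End wasserstein.

Section wasserstein_bound.
Context {R : realType}.
Notation lam := (@lebesgue_measure R).
Variable nu : probability R R.
Hypothesis nu_normal : forall A : set R, measurable A -> nu A = normal_prob 0 1 A.

Lemma measurable_inv_sqr (c : R) (D E : set R) : open E -> D `<=` E -> measurable D ->
  (forall x, E x -> x != 0) -> measurable_fun D (fun x : R => (c / x ^+ 2)%:E).
Proof.
move=> oE DE mD E0; apply/measurable_EFinP; apply: (@measurable_funS _ _ _ _ E) => //.
  exact: open_measurable.
apply: open_continuous_measurable_fun => // x; rewrite inE => /E0 x0.
apply: cvgM; first exact: cvg_cst.
by apply: cvgV; [rewrite expf_neq0|exact: exprn_continuous].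
Qed.

(** On the interval from [- 1 / u] to [1 / u] the distance is [O(u ^+ 2)] over a length [2 / u]; outside,
    the integrand is at most [22 / x ^+ 2], whose integral on each side is
    [22 * u]. *)
Lemma L1_dist_cdf_le (mu1 : probability R R) (A u : R) : 0 < u <= 1 -> 0 <= A ->
  measurable_fun setT (fun t : R => mu1 `]-oo, t]%classic) ->
  measurable_fun setT (fun t : R => nu `]-oo, t]%classic) ->
  tails_le mu1 22 -> gauss_close mu1 id (A * u ^+ 15) ->
  (L1_dist (fun t : R => mu1 `]-oo, t]%classic) (fun t : R => nu `]-oo, t]%classic) <=
    ((114 + 24 * A * (@abs_moment3 R)) * u)%:E)%E.
Proof.
move=> u01 A0 mf1 mf2 tail1 close1; have /andP[u0 u1] := u01.
have M0 := @abs_moment3_ge0 R.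
pose g t := `|fine (mu1 `]-oo, t]%classic) - fine (nu `]-oo, t]%classic)|.
have mg : measurable_fun setT g.
  apply: (measurableT_comp (@normr_measurable R setT)); apply: measurable_funB.
    by apply: (measurableT_comp _ mf1); exact: fine_measurable.
  by apply: (measurableT_comp _ mf2); exact: fine_measurable.
have mgE : measurable_fun setT (fun t => (g t)%:E) by exact/measurable_EFinP.
have g0 t : (0 <= (g t)%:E)%E by rewrite lee_fin /g.
rewrite /L1_dist (_ : (\int[lam]_t _)%E = (\int[lam]_t (g t)%:E)%E); last first.
  apply: eq_integral => t _; rewrite -[in LHS](@fineK _ (mu1 _)) ?fin_num_measure//.
  by rewrite -[in LHS](@fineK _ (nu _)) ?fin_num_measure.
pose r := u^-1; have r0 : 0 < r by rewrite invr_gt0.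
pose B1 : set R := `]-oo, (- r)%R]%classic; pose B2 : set R := `](- r)%R, r[%classic.
pose B3 : set R := `[r, +oo[%classic.
have mB1 : measurable B1 by exact: measurable_itv.
have mB2 : measurable B2 by exact: measurable_itv.
have mB3 : measurable B3 by exact: measurable_itv.
have mB12 : measurable (B1 `|` B2) by exact: measurableU.
have B12 : [disjoint B1 & B2].
  apply/disj_setPS => x []; rewrite /B1 /B2 /= !in_itv/= => xr /andP[rx _].
  by move: (lt_le_trans rx xr); rewrite ltxx.
have B123 : [disjoint (B1 `|` B2) & B3].
  apply/disj_setPS => x []; rewrite /B1 /B2 /B3 /= !in_itv/= andbT => -[xr|/andP[_ xr]] rx.
    have : r <= - r by exact: le_trans xr.
    by move=> rr; have : 0 < r := r0; lra.
  by move: (lt_le_trans xr rx); rewrite ltxx.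
have BT : B1 `|` B2 `|` B3 = setT.
  apply/seteqP; split => // x _.
  have [xr|xr] := leP x (- r); first by left; left; rewrite /B1 /= in_itv.
  have [xr'|xr'] := leP r x; first by right; rewrite /B3 /= in_itv/= andbT.
  by left; right; rewrite /B2 /= in_itv/= xr xr'.
rewrite -[X in (\int[lam]_(t in X) _)%E]BT.
rewrite ge0_integral_setU//=; last exact: measurable_funTS.
rewrite ge0_integral_setU//=; last exact: measurable_funTS.
have i1 : (\int[lam]_(t in B1) (g t)%:E <= (22 * u)%:E)%E.
  rewrite (_ : 22 * u = 22 / r); last by rewrite /r invrK.
  rewrite -(integral_inv_sqr_neg r 22 r0)//; apply: ge0_le_integral => //.
  - exact: measurable_funTS.
  - apply: (measurable_inv_sqr 22 B1 (`]-oo, 0[%classic : set R)) => //.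
    + by move=> x; rewrite /B1 /= !in_itv/= => h; apply: (le_lt_trans h); rewrite oppr_lt0.
    + by move=> x; rewrite /= in_itv/= => h; rewrite lt_eqF.
  - move=> x; rewrite /B1 /= in_itv/= => xr; rewrite lee_fin.
    by apply: cdf_tail_dist_le => //; rewrite lt_eqF// (le_lt_trans xr)// oppr_lt0.
have i3 : (\int[lam]_(t in B3) (g t)%:E <= (22 * u)%:E)%E.
  rewrite (_ : 22 * u = 22 / r); last by rewrite /r invrK.
  rewrite -(integral_inv_sqr r 22 r0)//; apply: ge0_le_integral => //.
  - exact: measurable_funTS.
  - apply: (measurable_inv_sqr 22 B3 `]0, +oo[%classic) => //.
    + by move=> x; rewrite /B3 /= !in_itv/= !andbT => h; exact: lt_le_trans h.
    + by move=> x; rewrite /= in_itv/= andbT => h; rewrite gt_eqF.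
  - move=> x; rewrite /B3 /= in_itv/= andbT => xr; rewrite lee_fin.
    by apply: cdf_tail_dist_le => //; rewrite gt_eqF// (lt_le_trans r0).
have i2 : (\int[lam]_(t in B2) (g t)%:E <= (((35 + 12 * A * (@abs_moment3 R)) * u ^+ 2) * (2 * r))%:E)%E.
  apply: (@le_trans _ _ (\int[lam]_(t in B2) ((35 + 12 * A * (@abs_moment3 R)) * u ^+ 2)%:E)%E).
    apply: ge0_le_integral => //; first exact: measurable_funTS.
    move=> x; rewrite /B2 /= in_itv/= => /andP[x1 x2]; rewrite lee_fin.
    by apply: cdf_dist_le => //; rewrite ler_norml -/r !ltW.
  rewrite integral_cst//= lebesgue_measure_itv/= lte_fin gtrN// -EFinD -EFinM lee_fin opprK.
  by rewrite (_ : 2 * r = r + r) ?lexx//; ring.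
apply: (le_trans (leeD (leeD i1 i2) i3)); rewrite -!EFinD lee_fin.
rewrite (_ : _ * u ^+ 2 * (2 * r) = 2 * (35 + 12 * A * (@abs_moment3 R)) * u); last first.
  by rewrite /r; field; rewrite gt_eqF.
lra.
Qed.
End wasserstein_bound.

(** * Standardized variables *)
Section standardized_moments.
Context {d : measure_display} {T : measurableType d} {R : realType}.
Variable P : probability T R.

Lemma expectationE (f : T -> R) : ('E_P[f] = \int[P]_w (f w)%:E)%E.
Proof. by rewrite unlock. Qed.

Lemma expectation_fine (f : T -> R) : fine 'E_P[f] = \int[P]_w f w.
Proof. by rewrite expectationE. Qed.

Lemma varianceE_integral (f : T -> R) :
  ('V_P[f] = \int[P]_w ((f w - fine 'E_P[f]) ^+ 2)%R%:E)%E.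
Proof.
rewrite /variance covariance.unlock [LHS]expectationE; apply: eq_integral => w _.
by rewrite expr2.
Qed.

Lemma standardize_moments (X : {RV P >-> R}) (c : R) :
  (0 < 'V_P[X])%E -> (central_moment4 P X <= c%:E)%E ->
  [/\ P.-integrable setT (EFin \o (fun w => (X w - fine 'E_P[X]) ^+ 4)),
      centered4 P (standardize P X) 1,
      0 < fine 'V_P[X], ('V_P[X] = (fine 'V_P[X])%:E)%E &
      (fine 'V_P[X]) ^+ 2 * \int[P]_w standardize P X w ^+ 4 <= c].
Proof.
move=> V0 M4; set m := fine 'E_P[X].
have mX : measurable_fun setT (fun w => X w - m) by exact: measurable_funB.
have X4 : P.-integrable setT (EFin \o (fun w => (X w - m) ^+ 4)).
  apply/integrableP; split.
    by apply/measurable_EFinP; exact: measurable_funX.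
  move: M4; rewrite /central_moment4 [leLHS]expectationE -/m => M4.
  apply: (@le_lt_trans _ _ c%:E); last exact: ltry.
  apply: le_trans M4; rewrite le_eqVlt; apply/orP; left; apply/eqP.
  by apply: eq_integral => w _ /=; rewrite ger0_norm// (exprM _ 2 2) sqr_ge0.
have iXm : P.-integrable setT (EFin \o (fun w => X w - m)) by exact: integrable1_of4.
have iX2 : P.-integrable setT (EFin \o (fun w => (X w - m) ^+ 2)) by exact: integrable2_of4.
have iX : P.-integrable setT (EFin \o X).
  have := integrable_add P _ _ iXm (integrable_cst P m).
  by under [X in _.-integrable _ X]eq_fun do rewrite /= subrK.
have Vfin : ('V_P[X] = (fine 'V_P[X])%:E)%E.
  by rewrite fineK// varianceE_integral integrable_fin_num.
have v0 : 0 < fine 'V_P[X] by rewrite -lte_fin -Vfin.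
have vE : fine 'V_P[X] = \int[P]_w (X w - m) ^+ 2 by rewrite varianceE_integral.
set v := fine 'V_P[X] in v0 vE *.
have s0 : 0 < Num.sqrt v by rewrite sqrtr_gt0.
have ssq : (Num.sqrt v) ^+ 2 = v by rewrite sqr_sqrtr// ltW.
have c4 : centered4 P (standardize P X) (((Num.sqrt v)^-1) ^+ 2 * v).
  have -> : standardize P X = (fun w => (Num.sqrt v)^-1 * (X w - m)).
    by apply/funext => w; rewrite /standardize mulrC.
  apply: centered4_scale; split => //.
  by rewrite RintegralB// ?Rintegral_cst_prob ?/m ?expectation_fine ?subrr//; exact: integrable_cst.
rewrite exprVn ssq mulVf ?gt_eqF// in c4.
split=> //.
have -> : \int[P]_w standardize P X w ^+ 4 = \int[P]_w ((v ^+ 2)^-1 * (X w - m) ^+ 4).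
  apply: eq_Rintegral => w _; rewrite /standardize -/m -/v exprMn mulrC; congr (_ * _).
  by rewrite exprVn (exprM _ 2 2) ssq.
rewrite RintegralZl// mulrA mulfV ?mul1r ?expf_neq0 ?gt_eqF//.
move: M4; rewrite /central_moment4 [leLHS]expectationE -/m => M4.
rewrite -lee_fin /Rintegral fineK ?integrable_fin_num//.
Qed.
End standardized_moments.

(** * One step of the recursion *)
Section one_step.
Context {d : measure_display} {T : measurableType d} {R : realType}.
Variable P : probability T R.

Lemma Rintegral_ae_eq (f g : T -> R) : measurable_fun setT f -> measurable_fun setT g ->
  {ae P, forall w, f w = g w} ->
  (\int[P]_w (f w)%:E = \int[P]_w (g w)%:E)%E.
Proof.
move=> mf mg fg; apply: ae_eq_integral => //; try exact/measurable_EFinP.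
by apply: filterS fg => w /= -> _.
Qed.

(** [U] is the weighted sum of the standardized copies.  With [s'] and [s] the
    standard deviations of [X'] and [X], the difference [s' * X'~ - lambda a * s * U]
    is almost surely the centred perturbation, so its second moment is the
    variance of [D]; [Rintegral_sqr_dist_le] turns this into a bound on the distance of the
    standardized variables. *)
Lemma recursion_approximant (k : nat) (a : 'I_k -> R) (X X' D : {RV P >-> R})
    (Xc : 'I_k -> {RV P >-> R}) (c c' v delta M : R) :
  (forall i, same_law (Xc i) X) -> mutually_independent Xc ->
  {ae P, forall w, X' w = \sum_(i < k) a i * Xc i w + D w} ->
  0 < lambda a ->
  (0 < 'V_P[X])%E -> (central_moment4 P X <= c%:E)%E ->
  (0 < 'V_P[X'])%E -> (central_moment4 P X' <= c'%:E)%E ->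
  ('V_P[D] <= v%:E)%E ->
  \int[P]_w standardize P X w ^+ 4 <= M ->
  gauss_close P (standardize P X) delta ->
  exists U : T -> R, [/\ centered4 P U 1,
    gauss_close P U (delta * \sum_i `|a i / lambda a| ^+ 3),
    \int[P]_w U w ^+ 4 <= 8 ^+ k * k%:R * M &
    \int[P]_w (standardize P X' w - U w) ^+ 2 <=
      v / (Num.sqrt (fine 'V_P[X']) * (lambda a * Num.sqrt (fine 'V_P[X])))].
Proof.
move=> law indep step la0 VX cX VX' cX' vD XM Xd.
have [X4 cW vX VXE _] := standardize_moments P X c VX cX.
have [X4' cW' vX' VXE' _] := standardize_moments P X' c' VX' cX'.
set m := fine 'E_P[X] in X4 *; set m' := fine 'E_P[X'] in X4' *.
set s := Num.sqrt (fine 'V_P[X]); set s' := Num.sqrt (fine 'V_P[X']).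
have s0 : 0 < s by rewrite sqrtr_gt0.
have s0' : 0 < s' by rewrite sqrtr_gt0.
pose g (x : R) := (x - m) / s.
have mg : measurable_fun setT g by apply: measurable_funM => //; exact: measurable_funB.
have mV i : measurable_fun setT (g \o Xc i) by exact: measurableT_comp.
pose V i := mfun_of _ (mV i).
have indV : mutually_independent (P := P) V.
  move=> A mA; apply: (indep (fun i => g @^-1` A i)) => i.
  by rewrite -[X in measurable X]setTI; exact: mg.
have [_ W4 W1 W2] := cW.
have gX : standardize P X = g \o X by [].
have iW := integrable1_of4 P _ (c4_meas _ _ _ cW) W4.
have iW2 := integrable2_of4 P _ (c4_meas _ _ _ cW) W4.
have m4 : measurable_fun setT (fun x => g x ^+ 4) by exact: measurable_funX.
have m2 : measurable_fun setT (fun x => g x ^+ 2) by exact: measurable_funX.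
have V4 i : centered4 P (V i) 1.
  split.
  - exact: mV.
  - exact: (integrable_same_law P (Xc i) X (fun x => g x ^+ 4) (law i) m4 W4).
  - by rewrite -W1; exact: (Rintegral_same_law P (Xc i) X g (law i) mg iW).
  - by rewrite -W2; exact: (Rintegral_same_law P (Xc i) X (fun x => g x ^+ 2) (law i) m2 iW2).
have VM i : \int[P]_w V i w ^+ 4 <= M.
  rewrite (le_trans _ XM)// le_eqVlt; apply/orP; left; apply/eqP.
  exact: (Rintegral_same_law P (Xc i) X (fun x => g x ^+ 4) (law i) m4 W4).
have Vd i : gauss_close P (V i) delta.
  move=> t u; rewrite (le_trans _ (Xd t u))// le_eqVlt; apply/orP; left; apply/eqP.
  congr (`| _ - _|).
  have mc : measurable_fun setT (fun x => cos (t * g x + u)) by exact: measurable_cos_affine.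
  apply: (Rintegral_same_law P (Xc i) X (fun x => cos (t * g x + u)) (law i) mc).
  exact: (integrable_cos_affine P (g \o X) t u (c4_meas _ _ _ cW)).
set la := lambda a in la0 *.
have laE : \sum_(i < k) a i ^+ 2 = la ^+ 2.
  by rewrite /la /lambda sqr_sqrtr// sumr_ge0// => i _; exact: sqr_ge0.
pose cc i := a i / la.
have cc1 : \sum_i cc i ^+ 2 = 1.
  under eq_bigr do rewrite /cc exprMn.
  by rewrite -mulr_suml laE exprVn divff// expf_neq0// gt_eqF.
have ccle i : `|cc i| <= 1.
  rewrite -(ler_sqr) ?nnegrE// expr1n real_normK ?num_real// -cc1 (bigD1 i)//=.
  by rewrite lerDl sumr_ge0// => j _; exact: sqr_ge0.
exists (fun w => \sum_i cc i * V i w).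
have cU : centered4 P (fun w => \sum_i cc i * V i w) 1.
  by rewrite -cc1; apply: centered4_lincomb => //; exact: index_enum_uniq.
split => //.
- exact: gauss_close_lincomb.
- have [_] := fourth_moment_lincomb P _ V cc (index_enum 'I_k) M ccle V4 VM.
  rewrite (_ : size (index_enum 'I_k) = k)// -[RHS](size_enum_ord k).
  apply/perm_size/uniq_perm; rewrite ?index_enum_uniq ?enum_uniq// => i.
  by rewrite mem_index_enum mem_enum.
apply: Rintegral_sqr_dist_le => //; first exact: mulr_gt0.
set U := (fun w => _) in cU *; set W' := standardize P X' in cW' *.
have [mW' W4' W1' _] := cW'; have [mU U4 U1 _] := cU.
have iW' := integrable1_of4 P _ mW' W4'.
have iU := integrable1_of4 P _ mU U4.
pose E w := s' * W' w - la * s * U w.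
have iE : P.-integrable setT (EFin \o E).
  by apply: integrable_sub; exact: integrable_scale.
have mE : measurable_fun setT E by exact/measurable_EFinP/(measurable_int P iE).
pose c0 := m' - \sum_i a i * m.
have ED : {ae P, forall w, D w = E w + c0}.
  apply: filterS step => w Xw.
  have Uw : la * s * U w = \sum_i a i * Xc i w - \sum_i a i * m.
    rewrite /U mulr_sumr -sumrB; apply: eq_bigr => i _.
    by rewrite /cc /V /= /g; field; rewrite !gt_eqF.
  rewrite /E Uw /c0 /W' /standardize -/m' -/s' Xw; field; rewrite gt_eqF //.
have mEc : measurable_fun setT (fun w => E w + c0) by exact: measurable_funD.
have EDc : fine 'E_P[D] = c0.
  rewrite expectationE (Rintegral_ae_eq D (fun w => E w + c0))//.
  have -> : fine (\int[P]_w (E w + c0)%:E)%E = \int[P]_w (E w + c0) by [].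
  rewrite RintegralD//; last exact: integrable_cst.
  rewrite Rintegral_cst_prob RintegralB//; [|exact: integrable_scale..].
  by rewrite !RintegralZl// W1' U1 !mulr0 subrr add0r.
have VDE : ('V_P[D] = \int[P]_w (E w ^+ 2)%:E)%E.
  rewrite varianceE_integral EDc.
  apply: (Rintegral_ae_eq (fun w => (D w - c0) ^+ 2) (fun w => E w ^+ 2)).
  - by apply: measurable_funX; exact: measurable_funB.
  - exact: measurable_funX.
  - by apply: filterS ED => w ->; rewrite addrK.
rewrite -lee_fin /Rintegral fineK; first by rewrite -VDE.
have := VDE.
rewrite ge0_fin_numE; last by apply: integral_ge0 => w _; rewrite lee_fin sqr_ge0.
by rewrite -/(E _) => <-; exact: le_lt_trans vD (ltry _).
Qed.
End one_step.

(** * Geometric decay *)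
Section geometric_recursion.
Context {R : realType}.

(** Any [gamma] strictly between [max kappa q] and 1 is propagated by the
    recursion once [K] is large; the finitely many indices below [N] only enlarge [K]. *)
Lemma geometric_recursion (G : nat -> R -> Prop) (B kappa q : R) (N : nat) :
  (forall n x y, x <= y -> G n x -> G n y) -> (forall n, exists x, G n x) ->
  0 <= B -> 0 <= kappa < 1 -> 0 < q < 1 ->
  (forall n x, (N <= n)%N -> 0 <= x -> G n x -> G n.+1 (kappa * x + B * q ^+ n)) ->
  exists K gamma : R, [/\ 0 < K, 0 < gamma < 1 & forall n, G n (K * gamma ^+ n)].
Proof.
move=> Gmono Gex B0 /andP[k0 k1] /andP[q0 q1] step.
have [D GD] := choice Gex.
pose gamma := (Num.max kappa q + 1) / 2.
have kg : kappa < gamma.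
  have : kappa <= Num.max kappa q by rewrite le_max lexx.
  by rewrite /gamma; lra.
have qg : q < gamma.
  have : q <= Num.max kappa q by rewrite le_max lexx orbT.
  by rewrite /gamma; lra.
have g1 : gamma < 1.
  have : Num.max kappa q < 1 by rewrite gt_max k1 q1.
  by rewrite /gamma; lra.
have g0 : 0 < gamma by exact: lt_trans qg.
pose K := 1 + B / (gamma - kappa) + \sum_(i < N.+1) `|D i| / gamma ^+ i.
have BK : B <= K * (gamma - kappa).
  rewrite -ler_pdivrMr ?subr_gt0// /K addrAC ler_wpDl// addr_ge0// sumr_ge0// => i _.
  by rewrite divr_ge0// exprn_ge0// ltW.
have K0 : 0 < K.
  rewrite /K -addrA ltr_wpDr// addr_ge0 ?sumr_ge0 ?divr_ge0 ?subr_ge0 ?(ltW kg)// => i _.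
  by rewrite divr_ge0// exprn_ge0// ltW.
exists K, gamma; split; [exact: K0|by rewrite g0 g1|].
have small n : (n <= N)%N -> G n (K * gamma ^+ n).
  move=> nN; apply: Gmono (GD n); rewrite -ler_pdivrMr ?exprn_gt0//.
  apply: (@le_trans _ _ (`|D n| / gamma ^+ n)).
    by rewrite ler_wpM2r ?invr_ge0 ?exprn_ge0 ?(ltW g0) ?ler_norm.
  have nN1 : (n < N.+1)%N by [].
  rewrite /K (bigD1 (Ordinal nN1))//= addrCA lerDl addr_ge0//.
    by rewrite addr_ge0// divr_ge0// subr_ge0 ltW.
  by apply: sumr_ge0 => i _; rewrite divr_ge0// exprn_ge0// ltW.
elim=> [|n IH]; first exact: small.
have [nN|Nn] := leqP n.+1 N; first exact: small.
have x0 : 0 <= K * gamma ^+ n by rewrite mulr_ge0 ?exprn_ge0 ?ltW.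
apply: Gmono (step n _ Nn x0 IH).
have qgn : q ^+ n <= gamma ^+ n by rewrite lerXn2r ?nnegrE ?ltW.
have gn0 : 0 <= gamma ^+ n by rewrite exprn_ge0// ltW.
apply: (@le_trans _ _ (kappa * (K * gamma ^+ n) + B * gamma ^+ n)).
  by rewrite lerD2l ler_wpM2l.
apply: (@le_trans _ _ (kappa * (K * gamma ^+ n) + K * (gamma - kappa) * gamma ^+ n)).
  by rewrite lerD2l ler_wpM2r.
by rewrite exprS le_eqVlt; apply/orP; left; apply/eqP; ring.
Qed.

Lemma lambda_gt0 (k : nat) (a : 'I_k -> R) i : a i != 0 -> 0 < lambda a.
Proof.
move=> ai; rewrite sqrtr_gt0 (bigD1 i)//= ltr_wpDr ?exprn_even_gt0//.
by apply: sumr_ge0 => j _; exact: sqr_ge0.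
Qed.

(** The squares of the weights sum to 1, and no single weight reaches 1 because two
    coefficients are nonzero. *)
Lemma sum_cube_weights_lt1 (k : nat) (a : 'I_k -> R) (i j : 'I_k) :
  i != j -> a i != 0 -> a j != 0 -> \sum_l `|a l / lambda a| ^+ 3 < 1.
Proof.
move=> ij ai aj; have la0 := lambda_gt0 _ a i ai.
set c := fun l => `|a l / lambda a|.
have c1 : \sum_l c l ^+ 2 = 1.
  rewrite /c; under eq_bigr do rewrite real_normK ?num_real// exprMn.
  rewrite -mulr_suml exprVn -[X in X / _](@sqr_sqrtr _ (\sum_l a l ^+ 2)).
    by rewrite divff// expf_neq0// gt_eqF.
  by rewrite sumr_ge0// => l _; exact: sqr_ge0.
have clt l : a l != 0 -> c l < 1.
  move=> al; have [m [ml am]] : exists m, m != l /\ a m != 0.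
    by have [e|ne] := eqVneq i l; [exists j; rewrite -e eq_sym|exists i].
  rewrite -(ltr_sqr) ?nnegrE ?normr_ge0// expr1n -c1 (bigD1 l)//= ltrDl (bigD1 m)//=.
  rewrite ltr_wpDr ?sumr_ge0// => [p _|]; first exact: sqr_ge0.
  by rewrite exprn_gt0// normr_gt0 mulf_neq0// invr_eq0 gt_eqF.
rewrite -c1; rewrite (bigD1 i)//= [ltRHS](bigD1 i)//=; apply: ltr_leD.
  rewrite exprSr gtr_pMr ?clt// exprn_gt0// normr_gt0 mulf_neq0// invr_eq0 gt_eqF//.
apply: ler_sum => l _; rewrite -/(c l).
have [al|al] := eqVneq (a l) 0; first by rewrite /c al mul0r normr0 !expr0n.
by rewrite exprSr ler_piMr ?sqr_ge0// ltW// clt.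
Qed.

Lemma cvg_finite_sum (I : Type) (r : seq I) (f : nat -> I -> R) (l : I -> R) :
  (forall i, f n i @[n --> \oo] --> l i) ->
  \sum_(i <- r) f n i @[n --> \oo] --> \sum_(i <- r) l i.
Proof.
move=> fl; elim: r => [|i r IH].
  by rewrite big_nil; under eq_fun do rewrite big_nil; exact: cvg_cst.
by rewrite big_cons; under eq_fun do rewrite big_cons; exact: cvgD.
Qed.

Lemma cvg_lambda (k : nat) (a : nat -> 'I_k -> R) (alim : 'I_k -> R) :
  (forall i, a n i @[n --> \oo] --> alim i) ->
  lambda (a n) @[n --> \oo] --> lambda alim.
Proof.
move=> acv; apply: (cvg_comp (fun n => \sum_(i < k) a n i ^+ 2) (@Num.sqrt R)); last exact: sqrt_continuous.
apply: cvg_finite_sum => i.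
by apply: (cvg_comp (fun n => a n i) (fun x : R => x ^+ 2)); [exact: acv|exact: exprn_continuous].
Qed.

Lemma sum_cube_weights_cvg (k : nat) (a : nat -> 'I_k -> R) (alim : 'I_k -> R) :
  (forall i, a n i @[n --> \oo] --> alim i) -> 0 < lambda alim ->
  \sum_l `|a n l / lambda (a n)| ^+ 3 @[n --> \oo] --> \sum_l `|alim l / lambda alim| ^+ 3.
Proof.
move=> acv la0; apply: cvg_finite_sum => i.
apply: (cvg_comp (fun n => `|a n i / lambda (a n)|) (fun x : R => x ^+ 3)); last exact: exprn_continuous.
apply: cvg_norm; apply: cvgM => //; apply: cvgV; first by rewrite gt_eqF.
exact: cvg_lambda.
Qed.
End geometric_recursion.

Section single_recursion.
Context {d : measure_display} {T : measurableType d} {R : realType}.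
Variable P : probability T R.

Lemma recursion_gauss_close (k : nat) (a : nat -> 'I_k -> R) (alim : 'I_k -> R)
    (X : nat -> {RV P >-> R}) (Xc : nat -> 'I_k -> {RV P >-> R})
    (D : nat -> {RV P >-> R}) (dX2 dD2 CX2 CD2 dX4 dD4 CX4 CD4 : R) :
  approx_linear_recursion a X Xc D ->
  variance_condition a alim X D dX2 dD2 CX2 CD2 ->
  fourth_moment_condition alim X D dX2 dD2 dX4 dD4 CX4 CD4 ->
  exists K gamma : R, [/\ 0 < K, 0 < gamma < 1 &
    forall n, gauss_close P (standardize P (X n)) (K * gamma ^+ n)].
Proof.
move=> [_ _ _ law indep step] [acv [i [j [ij ai aj]]] [/andP[d0 dd] d1] [CX0 CD0] lower upper].
move=> [[d4 _] ratio _ [C40 _] fourth _].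
set L := lambda alim in lower upper fourth.
have L0 : 0 < L by exact: lambda_gt0 ai.
set al := 1 - dX2 in lower ratio *; set be := 1 - dD2 in upper ratio *.
set f := 1 + dX4 in fourth ratio *.
have al0 : 0 < al by rewrite /al; lra.
have be0 : 0 < be by rewrite /be; lra.
have f1 : 1 <= f by rewrite /f; lra.
have al1 : al < 1 by rewrite /al; lra.
have f0 : 0 < f by exact: lt_le_trans f1.
pose rho := be / al; pose r := f / al.
have rho0 : 0 < rho by rewrite divr_gt0.
have r0 : 0 < r by rewrite divr_gt0.
have r1 : 1 <= r by rewrite /r ler_pdivlMr// mul1r (le_trans (ltW al1)).
pose q := rho * r ^+ 2.
have q0 : 0 < q by rewrite mulr_gt0// exprn_gt0.
have q1 : q < 1.
  apply: le_lt_trans ratio; rewrite (_ : be * f ^+ 3 / al ^+ 4 = q * r); last first.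
    by rewrite /q /rho /r; field; rewrite gt_eqF.
  by rewrite ler_peMr// ltW.
pose c n := CX4 ^+ 4 * L ^+ (4 * n) * f ^+ (4 * n).
pose v n := CD2 ^+ 2 * L ^+ (2 * n) * be ^+ (2 * n).
have VX n : (0 < 'V_P[X n])%E.
  by apply: lt_le_trans (lower n); rewrite lte_fin !mulr_gt0// exprn_gt0.
have std n := standardize_moments P (X n) (c n) (VX n) (fourth n).
pose s n := Num.sqrt (fine 'V_P[X n]).
have sE n : (s n) ^+ 2 = fine 'V_P[X n].
  by rewrite sqr_sqrtr// ltW//; have [] := std n.
have s0 n : 0 < s n by rewrite sqrtr_gt0; have [] := std n.
have slow n : CX2 * (L ^+ n * al ^+ n) <= s n.
  rewrite -(ler_sqr) ?nnegrE ?(ltW (s0 n))//; last first.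
    by rewrite mulr_ge0 ?(ltW CX0)// mulr_ge0// exprn_ge0// ltW.
  rewrite sE -lee_fin; have [_ _ _ <- _] := std n; apply: le_trans (lower n).
  by rewrite lee_fin !exprMn -!exprM (mulnC n) mulrA.
pose M0 := (CX4 / CX2) ^+ 4.
have M00 : 0 <= M0 by rewrite exprn_ge0// divr_ge0// ltW.
have WM n : \int[P]_w standardize P (X n) w ^+ 4 <= M0 * (r ^+ 4) ^+ n.
  have [_ _ _ _] := std n; rewrite -sE -(exprM (s n) 2 2) mulrC -ler_pdivlMr ?exprn_gt0// => h.
  apply: (le_trans h); rewrite ler_pdivrMr ?exprn_gt0//.
  apply: (@le_trans _ _ (M0 * (r ^+ 4) ^+ n * (CX2 * (L ^+ n * al ^+ n)) ^+ 4)).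
    rewrite le_eqVlt; apply/orP; left; apply/eqP.
    rewrite /c /M0 /r !expr_div_n -!exprM !(mulnC 4) !exprM.
    have := exprn_gt0 n al0; have := exprn_gt0 n L0.
    move: (al ^+ n) (L ^+ n) (f ^+ n) => x y z y0 x0.
    by field; rewrite !gt_eqF.
  have S0 : 0 <= CX2 * (L ^+ n * al ^+ n).
    by rewrite mulr_ge0 ?(ltW CX0)// mulr_ge0// exprn_ge0// ltW.
  apply: ler_wpM2l; first by apply: mulr_ge0 => //; rewrite !exprn_ge0// ltW.
  by apply: (@lerXn2r _ 4); rewrite ?nnegrE// ltW.
set kinf := \sum_l `|alim l / L| ^+ 3.
have kinf1 : kinf < 1 by exact: sum_cube_weights_lt1 ij ai aj.
have kinf0 : 0 <= kinf by rewrite sumr_ge0// => l _; rewrite exprn_ge0.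
pose kappa := (kinf + 1) / 2.
(* [kappa] lies strictly between the limit [kinf] and 1. *)
have [N _ HN] : \forall n \near \oo,
    L / 2 <= lambda (a n) /\ \sum_l `|a n l / lambda (a n)| ^+ 3 <= kappa.
  near=> n; split; near: n.
    apply: (cvgr_ge (lambda alim)); first exact: cvg_lambda.
    by rewrite -/L; lra.
  apply: (cvgr_le kinf); last by rewrite /kappa; lra.
  exact: sum_cube_weights_cvg.
pose A0 := 2 * CD2 ^+ 2 / (CX2 ^+ 2 * L ^+ 2 * al).
pose M1 := M0 * (r ^+ 4 + 8 ^+ k * k%:R).
have A00 : 0 <= A0.
  by rewrite divr_ge0 ?mulr_ge0 ?exprn_ge0// ltW.
have M10 : 0 <= M1.
  apply: mulr_ge0 => //; apply: addr_ge0; first by rewrite exprn_ge0// ltW.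
  by apply: mulr_ge0 => //; exact: exprn_ge0.
apply: (geometric_recursion (fun n x => gauss_close P (standardize P (X n)) x)
  (2 * (A0 + 4 * M1)) kappa q N).
- by move=> n x y; exact: gauss_close_le.
- move=> n; exists (2 * (1 + \int[P]_w standardize P (X n) w ^+ 4) + 1).
  by apply: gauss_close_crude; have [] := std n.
- by rewrite mulr_ge0// addr_ge0// mulr_ge0.
- by rewrite /kappa; apply/andP; split; lra.
- by rewrite q0 q1.
move=> n x Nn x0 Wx.
have [laL lak] := HN n Nn.
have la0 : 0 < lambda (a n) by apply: lt_le_trans laL; rewrite divr_gt0.
have [U [cU Ud U4 WU]] := recursion_approximant P k (a n) (X n) (X n.+1) (D n) (Xc n)
  (c n) (c n.+1) (v n) x _ (law n) (indep n) (step n) la0 (VX n) (fourth n)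
  (VX n.+1) (fourth n.+1) (upper n) (WM n) Wx.
have [_ cW' _ _ _] := std n.+1.
rewrite -/(s n) -/(s n.+1) in WU.
have rn0 : 0 <= (r ^+ 4) ^+ n by rewrite !exprn_ge0// ltW.
have WA : \int[P]_w (standardize P (X n.+1) w - U w) ^+ 2 <= A0 * (rho ^+ n) ^+ 2.
  apply: (le_trans WU); rewrite ler_pdivrMr ?mulr_gt0//.
  apply: (@le_trans _ _ (A0 * (rho ^+ n) ^+ 2 *
    (CX2 * (L ^+ n.+1 * al ^+ n.+1) * (L / 2 * (CX2 * (L ^+ n * al ^+ n)))))).
    rewrite le_eqVlt; apply/orP; left; apply/eqP.
    rewrite /v /A0 /rho expr_div_n !(mulnC 2) !exprM !exprS.
    have := exprn_gt0 n al0; have := exprn_gt0 n L0.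
    move: (al ^+ n) (L ^+ n) (be ^+ n) => y z w z0 y0.
    by field; rewrite !gt_eqF.
  have Sn m : 0 <= CX2 * (L ^+ m * al ^+ m).
    by rewrite mulr_ge0 ?(ltW CX0)// mulr_ge0// exprn_ge0// ltW.
  apply: ler_wpM2l; first by apply: mulr_ge0 => //; rewrite !exprn_ge0// ltW.
  by apply: ler_pM => //; [rewrite mulr_ge0 ?divr_ge0 ?(ltW L0)|apply: ler_pM => //; rewrite divr_ge0 ?(ltW L0)].
have WM1 : \int[P]_w standardize P (X n.+1) w ^+ 4 <= M1 * (r ^+ 4) ^+ n.
  apply: (le_trans (WM n.+1)); rewrite exprS mulrA ler_wpM2r//.
  by rewrite /M1 ler_wpM2l// lerDl mulr_ge0// exprn_ge0.
have UM1 : \int[P]_w U w ^+ 4 <= M1 * (r ^+ 4) ^+ n.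
  apply: (le_trans U4); rewrite mulrA ler_wpM2r// /M1 mulrC ler_wpM2l//.
  by rewrite lerDr exprn_ge0// ltW.
(* This weight turns both error terms into multiples of [q ^+ n]. *)
have e0 : 0 < (rho / r ^+ 2) ^+ n by rewrite exprn_gt0// divr_gt0// exprn_gt0.
have := gauss_close_perturb P _ U _ _ _ _ cW' cU e0 WA WM1 UM1 Ud.
apply: gauss_close_le; apply: lerD.
  by rewrite mulrC ler_wpM2r.
rewrite le_eqVlt; apply/orP; left; apply/eqP.
have r2 : (r ^+ 2) ^+ n = (r ^+ n) ^+ 2 by rewrite -!exprM mulnC.
have r4 : (r ^+ 4) ^+ n = (r ^+ n) ^+ 4 by rewrite -!exprM mulnC.
have qn : q ^+ n = rho ^+ n * (r ^+ n) ^+ 2 by rewrite -r2 -exprMn.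
have en : (rho / r ^+ 2) ^+ n = rho ^+ n / (r ^+ n) ^+ 2 by rewrite -r2 -expr_div_n.
rewrite qn en r4.
have := exprn_gt0 n rho0; have := exprn_gt0 n r0.
move: (rho ^+ n) (r ^+ n) => y z z0 y0.
by field; rewrite !gt_eqF.
Unshelve. all: by end_near. Qed.
End single_recursion.

(** * The sum of the two models *)
Section sum_of_two_models.
Context {d : measure_display} {T : measurableType d} {R : realType}.
Variable P : probability T R.

(** Chebyshev gives the constant 1; 22 is the constant available for the normal
    law, and a common one is convenient. *)
Lemma tails_of_centered4 (W : {RV P >-> R}) : centered4 P W 1 ->
  tails_le (distribution P W) 22.
Proof.
move=> [mW W4 W1 W2] r r0.
have EW : fine 'E_P[W] = 0 by rewrite expectation_fine.
have iW2 := integrable2_of4 P _ mW W4.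
have VW : ('V_P[W] = 1%:E)%E.
  rewrite varianceE_integral EW -W2 /Rintegral fineK ?integrable_fin_num//.
  by apply: eq_integral => w _; rewrite subr0.
have := chebyshev W r0; rewrite VW EW mule1 => h.
apply: (@le_trans _ _ (r ^- 2)%:E); last first.
  by rewrite lee_fin ler_peMl ?invr_ge0 ?exprn_ge0 ?ler1n// ltW.
apply: le_trans h; rewrite le_eqVlt; apply/orP; left; apply/eqP.
by rewrite /distribution /pushforward; congr (P _); apply/seteqP; split => w /=; rewrite subr0.
Qed.

Lemma gauss_close_distribution (W : {RV P >-> R}) (delta : R) :
  gauss_close P W delta -> gauss_close (distribution P W) id delta.
Proof.
move=> Wd t s; have := Wd t s; rewrite /Rintegral.
have mc : measurable_fun setT (fun w : R => (cos (t * w + s))%:E).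
  by apply/measurable_EFinP; apply: (measurable_cos_affine id); exact: measurable_id.
rewrite (@integral_distribution _ _ _ _ _ P W (fun w : R => (cos (t * w + s))%:E) mc)//.
exact: integrable_cos_affine.
Qed.

Lemma standardize_add (X Y : {RV P >-> R}) :
  indep_pair P (standardize P X) (standardize P Y) ->
  centered4 P (standardize P X) 1 -> centered4 P (standardize P Y) 1 ->
  0 < fine 'V_P[X] -> 0 < fine 'V_P[Y] ->
  exists a b : R, a ^+ 2 + b ^+ 2 = 1 /\
    (standardize P (X \+ Y)%R = fun w => a * standardize P X w + b * standardize P Y w).
Proof.
move=> ind cX cY vX vY.
set s := Num.sqrt (fine 'V_P[X]); set u := Num.sqrt (fine 'V_P[Y]).
have s0 : 0 < s by rewrite sqrtr_gt0.
have u0 : 0 < u by rewrite sqrtr_gt0.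
set m := fine 'E_P[X]; set p := fine 'E_P[Y].
have sX w : X w - m = s * standardize P X w.
  by rewrite /standardize -/m -/s mulrC divfK// gt_eqF.
have uY w : Y w - p = u * standardize P Y w.
  by rewrite /standardize -/p -/u mulrC divfK// gt_eqF.
have csX := centered4_scale P _ s _ cX; have cuY := centered4_scale P _ u _ cY.
rewrite !mulr1 in csX cuY.
pose sXm := mfun_of _ (c4_meas _ _ _ csX); pose uYm := mfun_of _ (c4_meas _ _ _ cuY).
have ind' : indep_pair P sXm uYm.
  apply: (indep_pair_comp P (standardize P X) (standardize P Y) (fun x => s * x) (fun x => u * x)) => //;
    exact: measurable_funM.
have [mS S4 S1 S2] := centered4_add P sXm uYm _ _ ind' csX cuY.
have XYE w : X w + Y w = (sXm w + uYm w) + (m + p).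
  by rewrite /sXm /uYm /= -sX -uY; ring.
have iS := integrable1_of4 P _ mS S4.
have mE : fine 'E_P[(X \+ Y)%R] = m + p.
  rewrite expectation_fine.
  have -> : (X \+ Y)%R = (fun w => (sXm w + uYm w) + (m + p)) by apply/funext.
  by rewrite RintegralD ?Rintegral_cst_prob ?S1 ?add0r//; exact: integrable_cst.
have vE : fine 'V_P[(X \+ Y)%R] = s ^+ 2 + u ^+ 2.
  rewrite varianceE_integral mE -S2; congr fine; apply: eq_integral => w _.
  by rewrite /= XYE addrK.
have n0 : 0 < Num.sqrt (s ^+ 2 + u ^+ 2) by rewrite sqrtr_gt0 addr_gt0 ?exprn_gt0.
exists (s / Num.sqrt (s ^+ 2 + u ^+ 2)), (u / Num.sqrt (s ^+ 2 + u ^+ 2)); split.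
  rewrite !expr_div_n (@sqr_sqrtr _ (s ^+ 2 + u ^+ 2)); last by rewrite addr_ge0 ?sqr_ge0.
  by rewrite -mulrDl divff// gt_eqF// addr_gt0 ?exprn_gt0.
apply/funext => w; rewrite {1}/standardize mE vE /= XYE addrK /sXm /uYm /=.
by rewrite mulrDl mulrAC [u * _ / _]mulrAC.
Qed.

Lemma standardize_indep (X Y : {RV P >-> R}) :
  indep_pair P X Y -> indep_pair P (standardize P X) (standardize P Y).
Proof.
move=> XY.
apply: (indep_pair_comp P X Y (fun x => (x - fine 'E_P[X]) / Num.sqrt (fine 'V_P[X]))
  (fun x => (x - fine 'E_P[Y]) / Num.sqrt (fine 'V_P[Y]))) => //;
  by apply: measurable_funM => //; exact: measurable_funB.
Qed.
End sum_of_two_models.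

Lemma bernoulli_inequality (R : realType) (x : R) (n : nat) : 0 <= x <= 1 ->
  1 - n%:R * x <= (1 - x) ^+ n.
Proof.
move=> /andP[x0 x1]; elim: n => [|n IH]; first by rewrite mul0r subr0.
rewrite exprS; apply: (@le_trans _ _ ((1 - x) * (1 - n%:R * x))); last first.
  by rewrite ler_wpM2l// subr_ge0.
rewrite (_ : (1 - x) * (1 - n%:R * x) = 1 - n.+1%:R * x + n%:R * (x * x)); last first.
  by rewrite -natr1; ring.
by rewrite lerDl !mulr_ge0.
Qed.

Theorem theorem1p4 (R : realType)
  (d : measure_display) (T : measurableType d) (P : probability T R)
  (k l : nat)
  (a : nat -> 'I_k -> R) (b : nat -> 'I_l -> R)
  (X : nat -> {RV P >-> R}) (Xc : nat -> 'I_k -> {RV P >-> R})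
  (Delta : nat -> {RV P >-> R})
  (Y : nat -> {RV P >-> R}) (Yc : nat -> 'I_l -> {RV P >-> R})
  (Lambda : nat -> {RV P >-> R})
  (modelX : approx_linear_recursion a X Xc Delta)
  (modelY : approx_linear_recursion b Y Yc Lambda)
  (indepXY : forall n,
     independent_families (stage X Xc Delta n) (stage Y Yc Lambda n))
  (alim : 'I_k -> R) (blim : 'I_l -> R)
  (dX2 dD2 CX2 CD2 dX4 dD4 CX4 CD4 : R)
  (dY2 dL2 CY2 CL2 dY4 dL4 CY4 CL4 : R)
  (X1 : variance_condition a alim X Delta dX2 dD2 CX2 CD2)
  (X2 : fourth_moment_condition alim X Delta dX2 dD2 dX4 dD4 CX4 CD4)
  (Y1 : variance_condition b blim Y Lambda dY2 dL2 CY2 CL2)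
  (Y2 : fourth_moment_condition blim Y Lambda dY2 dL2 dY4 dL4 CY4 CL4)
  (ratioX : (1 - dL2) * (1 + dX4) ^+ 3 / ((1 - dY2) * (1 - dX2) ^+ 3) < 1)
  (ratioY : (1 - dD2) * (1 + dY4) ^+ 3 / ((1 - dX2) * (1 - dY2) ^+ 3) < 1)
  (var_close : forall n,
     (`| 'V_P[X n] - 'V_P[Y n] | <=
        ('V_P[Delta n] + 'V_P[Lambda n]) /
        (Num.max (lambda (a n) ^+ 2) (lambda (b n) ^+ 2))%:E)%E)
  (dZ : measure_display) (TZ : measurableType dZ) (PZ : probability TZ R)
  (Z : {RV PZ >-> R}) (normalZ : is_standard_normal Z) :
  exists C gamma : R, [/\ 0 < C, 0 < gamma < 1 &
    forall n, (L1_dist (cdf (standardize P (X n \+ Y n)%R : {RV P >-> R})) (cdf Z)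
      <= (C * gamma ^+ n)%:E)%E].
Proof.
have [KX [gX [KX0 /andP[gX0 gX1] closeX]]] := recursion_gauss_close P _ _ _ _ _ _ _ _ _ _ _ _ _ _ modelX X1 X2.
have [KY [gY [KY0 /andP[gY0 gY1] closeY]]] := recursion_gauss_close P _ _ _ _ _ _ _ _ _ _ _ _ _ _ modelY Y1 Y2.
pose g := Num.max gX gY.
have g0 : 0 < g by rewrite lt_max gX0.
have g1 : g < 1 by rewrite gt_max gX1.
(* [L1_dist_cdf_le] asks for a constant [A * u ^+ 15] and returns [O(u)]; by the
   Bernoulli inequality [h ^+ 15] still dominates the rate [g]. *)
pose h := 1 - (1 - g) / 15.
have h0 : 0 < h by rewrite /h; lra.
have h1 : h < 1 by rewrite /h; lra.
have gh : g <= h ^+ 15.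
  have x01 : 0 <= (1 - g) / 15 <= 1 by apply/andP; split; lra.
  by apply: le_trans (bernoulli_inequality _ _ 15 x01); lra.
pose A := KX + KY.
have A0 : 0 < A by rewrite addr_gt0.
have M0 := @abs_moment3_ge0 R.
exists (114 + 24 * A * (@abs_moment3 R)), h; split.
- by rewrite ltr_wpDr// !mulr_ge0// ltW.
- by rewrite h0.
move=> n.
have pos (k' : nat) (a' : nat -> 'I_k' -> R) al' (X' D' : nat -> {RV P >-> R}) d1 d2 c1 c2 :
  variance_condition a' al' X' D' d1 d2 c1 c2 -> (0 < 'V_P[X' n])%E.
  move=> [_ [i [_ [_ ai _]]] [/andP[d10 d12] d21] [c10 _] lower _].
  apply: lt_le_trans (lower n); rewrite lte_fin !mulr_gt0// exprn_gt0//.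
    exact: lambda_gt0 ai.
  by lra.
have [_ cX vX _ _] := standardize_moments P (X n) _ (pos _ _ _ _ _ _ _ _ _ X1) (fc_main X2 n).
have [_ cY vY _ _] := standardize_moments P (Y n) _ (pos _ _ _ _ _ _ _ _ _ Y1) (fc_main Y2 n).
have ind : indep_pair P (X n) (Y n).
  move=> B C mB mC; apply: indepXY; apply: sub_sigma_algebra; exists None => //.
    by exists B => //; rewrite setTI.
  by exists C => //; rewrite setTI.
have inds := standardize_indep P _ _ ind.
have [x [y [xy ZE]]] := standardize_add P (X n) (Y n) inds cX cY vX vY.
set Zn : {RV P >-> R} := standardize P (X n \+ Y n)%R.
have cxX := centered4_scale P _ x _ cX; have cyY := centered4_scale P _ y _ cY.
have cZ : centered4 P Zn 1.
  rewrite /Zn /= ZE -xy -(mulr1 (x ^+ 2)) -(mulr1 (y ^+ 2)).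
  apply: (centered4_add P (mfun_of _ (c4_meas _ _ _ cxX)) (mfun_of _ (c4_meas _ _ _ cyY))) => //.
  apply: (indep_pair_comp P (standardize P (X n)) (standardize P (Y n))
    (fun z => x * z) (fun z => y * z)) => //; exact: measurable_funM.
have unit_cube (z w : R) : z ^+ 2 + w ^+ 2 = 1 -> `|z| ^+ 3 <= 1.
  move=> zw; apply: exprn_ile1 => //.
  rewrite -ler_sqr ?nnegrE// expr1n real_normK ?num_real//.
  by have w2 := sqr_ge0 w; lra.
have decay (K c : R) : 0 < K -> 0 < c -> c <= g -> K * c ^+ n <= K * (h ^+ n) ^+ 15.
  move=> K0 c0 cg; rewrite ler_wpM2l ?(ltW K0)// -exprM mulnC exprM.
  by rewrite lerXn2r ?nnegrE ?exprn_ge0 ?(ltW c0) ?(ltW h0)// (le_trans cg).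
have hn0 : 0 <= (h ^+ n) ^+ 15 by rewrite !exprn_ge0// ltW.
have Zd : gauss_close P Zn (A * (h ^+ n) ^+ 15).
  rewrite /Zn /= ZE.
  have := gauss_close_pair P (standardize P (X n)) (standardize P (Y n)) x y _ _ inds
    (closeX n) (closeY n) xy.
  apply: gauss_close_le; rewrite /A mulrDl; apply: lerD.
    apply: (@le_trans _ _ (KX * (h ^+ n) ^+ 15 * 1)); last by rewrite mulr1.
    apply: ler_pM; [by rewrite mulr_ge0 ?exprn_ge0 ?(ltW KX0) ?(ltW gX0)|exact: exprn_ge0|..].
    - by apply: decay => //; rewrite le_max lexx.
    - exact: unit_cube xy.
  apply: (@le_trans _ _ (KY * (h ^+ n) ^+ 15 * 1)); last by rewrite mulr1.
  apply: ler_pM; [by rewrite mulr_ge0 ?exprn_ge0 ?(ltW KY0) ?(ltW gY0)|exact: exprn_ge0|..].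
  - by apply: decay => //; rewrite le_max lexx orbT.
  - by rewrite addrC in xy; exact: unit_cube xy.
apply: (L1_dist_cdf_le (distribution PZ Z) normalZ (distribution P Zn) A (h ^+ n)).
- by rewrite exprn_gt0// exprn_ile1// ltW.
- exact: ltW.
- exact: cdf_measurable.
- exact: cdf_measurable.
- exact: tails_of_centered4.
- exact: gauss_close_distribution.
Qed.
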